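(* (1) There is no sequence $(f_n)\subset\mathcal B_0$ such that $\lim_{n\to\infty}\|f_ng-g\|_{\mathcal B_0}=0$ for all $g\in\mathcal B_0$. (2) $\mathcal M_s(\mathcal B_0)=\mathcal B$, where $\mathcal M_s(\mathcal B_0):=\{m\in\operatorname{Hol}(\mathbb C_+): mf\in\mathcal B_0\text{ for all }f\in\mathcal B_0\}$.
   Context: $\mathbb C_+=\{z:\Re z>0\}$, $\operatorname{Hol}(\mathbb C_+)$ the holomorphic functions on $\mathbb C_+$. $\mathcal B$ is the Banach algebra of holomorphic $f$ on $\mathbb C_+$ with $\|f\|_{\mathcal B_0}:=\int_0^\infty\sup_{\beta\in\mathbb R}|f'(\alpha+i\beta)|\,d\alpha<\infty$, with norm $\|f\|_{\mathcal B}=\sup_{\mathbb C_+}|f|+\|f\|_{\mathcal B_0}$; $f(\infty):=\lim_{\Re z\to\infty}f(z)$ exists, and $\mathcal B_0:=\{f\in\mathcal B:f(\infty)=0\}$ (a closed ideal of $\mathcal B$, on which $\|\cdot\|_{\mathcal B_0}$ is an equivalent norm). *)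

(* Defs.v *)
From Stdlib Require Import Reals.
Open Scope R_scope.

Definition Cx := (R * R)%type.
Definition Cadd (z w : Cx) : Cx := (fst z + fst w, snd z + snd w).
Definition Csub (z w : Cx) : Cx := (fst z - fst w, snd z - snd w).
Definition Cmul (z w : Cx) : Cx :=
  (fst z * fst w - snd z * snd w, fst z * snd w + snd z * fst w).
Definition Cmod (z : Cx) : R := sqrt (fst z ^ 2 + snd z ^ 2).
Definition Re (z : Cx) : R := fst z.

Definition has_cderiv (f : Cx -> Cx) (z l : Cx) : Prop :=
  forall eps, 0 < eps -> exists delta, 0 < delta /\
    forall h : Cx, Cmod h < delta ->
      Cmod (Csub (Csub (f (Cadd z h)) (f z)) (Cmul l h)) <= eps * Cmod h.

Definition holo_on_Cplus (f df : Cx -> Cx) : Prop :=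
  forall z, 0 < Re z -> has_cderiv f z (df z).

(** A step function below M(a) := sup_{b in R} |df(a + i b)| on (0, oo):
    nodes 0 < x 0 < x 1 < ... < x k, value c i on [x i, x (S i)],
    with c i <= M(a) for every a in that interval. *)
Definition step_below (df : Cx -> Cx) (k : nat) (x c : nat -> R) : Prop :=
  0 < x O /\
  (forall i, (i < k)%nat -> x i < x (S i)) /\
  (forall i, (i < k)%nat -> forall a, x i <= a <= x (S i) ->
     forall c', c' < c i -> exists b, c' < Cmod (df (a, b))).

Fixpoint step_sum (k : nat) (x c : nat -> R) : R :=
  match k with
  | O => 0
  | S k' => step_sum k' x c + c k' * (x (S k') - x k')
  end.

(** int_0^oo sup_b |df(a+ib)| da <= K  (lower Darboux integral of the
    lower semicontinuous function M, which equals its Lebesgue integral). *)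
Definition B0int_le (df : Cx -> Cx) (K : R) : Prop :=
  forall k x c, step_below df k x c -> step_sum k x c <= K.

Definition B0norm_le (h : Cx -> Cx) (K : R) : Prop :=
  exists dh, holo_on_Cplus h dh /\ B0int_le dh K.

Definition inB (f : Cx -> Cx) : Prop :=
  exists df, holo_on_Cplus f df /\
    (exists K, forall z, 0 < Re z -> Cmod (f z) <= K) /\
    (exists K, B0int_le df K).

Definition inB0 (f : Cx -> Cx) : Prop :=
  inB f /\
  forall eps, 0 < eps -> exists A, forall z, A < Re z -> Cmod (f z) < eps.

Definition in_Ms (m : Cx -> Cx) : Prop :=
  (exists dm, holo_on_Cplus m dm) /\
  forall f, inB0 f -> inB0 (fun z => Cmul (m z) (f z)).

(* Main.v *)
(** Maximum principle. If f is bounded and holomorphic on Re z > 0 and |f| <= K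
    on Re z = 1, then |f| <= K on Re z > 1: after normalising f(0) = 1 at the
    point in question and K < 1, a power of f times a decaying factor gives F
    with F(0) = 1, and (F-1)^2/s is holomorphic but has a contour integral with
    positive imaginary part.

    (1) If (f_n) were an approximate identity, testing on exp(-z) would give
    f_n -> 1 uniformly on Re z = 1, hence on Re z >= 1 by the maximum principle,
    although f_n(oo) = 0.

    (2) B multiplies B_0 into itself because the vertical supremum of |f'| is
    lower semicontinuous, so its lower Darboux integral is subadditive.
    Conversely, if m multiplies B_0 into itself, then m exp(-dz) is bounded for
    every d > 0, so m is bounded by the maximum principle, and then m' f has a
    finite integral for every f in B_0; a gliding hump built from the functions
    exp(-dz) shows that the integral of m' itself is finite. *)
Require Import Defs.
From Stdlib Require Import Reals Arith Lra Lia Psatz Classical ClassicalEpsilon.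
From Coquelicot Require Import Coquelicot.
Open Scope R_scope.

(** Derivatives are given only pointwise; continuity of f' is not part of [holo_on_Cplus]. Claims
    that usually rest on it are proved by bisection: an interval or rectangle violating the claim is
    halved until it shrinks to a point, where differentiability decides. Goursat's theorem,
    subadditivity of the integral and the bound of an increment by the integral all follow this
    pattern.

    A multiplier is tested only against functions vanishing at infinity, so no single test bounds m
    there. The maximum principle carries the bound from Re z = 1 to the right with a constant
    independent of d, and only then can d tend to 0.

    In the gliding hump, the term 100^-n exp(-d_n z) keeps modulus at least 100^-n / 3 on its strip
    because d_n Re z <= 1 there. Earlier terms have already decayed and later coefficients are
    small, so all other terms together stay below 100^-n / 20, leaving |f| >= 100^-n / 4. The ratio
    1/100 is chosen for this margin. *)

Lemma Cmod_sub_ge (z w : C) : Cmod z - Cmod w <= Cmod (z - w)%C.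
Proof.
  pose proof (Cmod_triangle (z - w) w) as H.
  replace (z - w + w)%C with z in H by ring. lra.
Qed.

Lemma Cmod_sub_le (z w : C) : Cmod (z - w)%C <= Cmod z + Cmod w.
Proof. unfold Cminus. rewrite <- (Cmod_opp w). apply Cmod_triangle. Qed.

Lemma Cmod_sub_sym (z w : C) : Cmod (z - w)%C = Cmod (w - z)%C.
Proof. rewrite <- Cmod_opp. f_equal. ring. Qed.

Lemma fst_le_Cmod (z : C) : Rabs (fst z) <= Cmod z.
Proof. exact (Rle_trans _ _ _ (Rmax_l _ _) (Rmax_Cmod z)). Qed.

Lemma snd_le_Cmod (z : C) : Rabs (snd z) <= Cmod z.
Proof. exact (Rle_trans _ _ _ (Rmax_r _ _) (Rmax_Cmod z)). Qed.

Lemma Cmod_le_abs_sum (z : C) : Cmod z <= Rabs (fst z) + Rabs (snd z).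
Proof.
  replace z with (RtoC (fst z) + Ci * RtoC (snd z))%C at 1.
  2: { destruct z; unfold RtoC, Ci, Cplus, Cmult; simpl; f_equal; ring. }
  eapply Rle_trans; [apply Cmod_triangle|].
  rewrite Cmod_mult, Cmod_Ci, !Cmod_R. lra.
Qed.

(** * Calculus of complex derivatives *)

Lemma has_cderiv_lip (f : C -> C) (z l : C) : has_cderiv f z l ->
  exists delta, 0 < delta /\ forall h : C, Cmod h < delta ->
    Cmod (f (z + h) - f z)%C <= (Cmod l + 1) * Cmod h.
Proof.
  intros H. destruct (H 1 Rlt_0_1) as [d [d0 Hd]]. exists d. split; [exact d0|].
  intros h Hh. specialize (Hd h Hh).
  change (Cmod (f (z + h) - f z - l * h)%C <= 1 * Cmod h) in Hd.
  replace (f (z + h) - f z)%C with (f (z + h) - f z - l * h + l * h)%C by ring.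
  eapply Rle_trans; [apply Cmod_triangle|]. rewrite Cmod_mult. lra.
Qed.

Lemma has_cderiv_continuous (f : C -> C) (z l : C) : has_cderiv f z l ->
  forall eps, 0 < eps -> exists delta, 0 < delta /\ forall h : C, Cmod h < delta ->
    Cmod (f (z + h) - f z)%C < eps.
Proof.
  intros H eps He. destruct (has_cderiv_lip _ _ _ H) as [d [d0 Hd]].
  pose proof (Cmod_ge_0 l) as Hl.
  assert (Hq : 0 < eps / (Cmod l + 1)) by (apply Rdiv_lt_0_compat; lra).
  exists (Rmin d (eps / (Cmod l + 1))). split; [apply Rmin_pos; assumption|].
  intros h Hh.
  eapply Rle_lt_trans; [apply Hd; eapply Rlt_le_trans; [exact Hh|apply Rmin_l]|].
  assert (H2 : Cmod h < eps / (Cmod l + 1))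
    by (eapply Rlt_le_trans; [exact Hh|apply Rmin_r]).
  apply (Rmult_lt_compat_l (Cmod l + 1)) in H2; [|lra].
  replace ((Cmod l + 1) * (eps / (Cmod l + 1))) with eps in H2 by (field; lra). exact H2.
Qed.

(** A second-order remainder is below eps |h| once |h| < eps / (|K| + 1). Affine functions,
    inversion, exponentials and lacunary sums are all differentiated through such a remainder. *)
Lemma has_cderiv_quadratic (f : C -> C) (z l : C) (K d : R) : 0 < d ->
  (forall h : C, Cmod h < d -> Cmod (f (z + h) - f z - l * h)%C <= K * Cmod h ^ 2) ->
  has_cderiv f z l.
Proof.
  intros d0 H eps He. exists (Rmin d (eps / (Rabs K + 1))).
  pose proof (Rabs_pos K) as HK.
  assert (Hq : 0 < eps / (Rabs K + 1)) by (apply Rdiv_lt_0_compat; lra).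
  split; [apply Rmin_pos; assumption|].
  intros h Hh.
  change (Cmod (f (z + h) - f z - l * h)%C <= eps * Cmod h).
  change (Cmod h < Rmin d (eps / (Rabs K + 1))) in Hh.
  eapply Rle_trans; [apply H; eapply Rlt_le_trans; [exact Hh|apply Rmin_l]|].
  assert (H2 : Cmod h < eps / (Rabs K + 1))
    by (eapply Rlt_le_trans; [exact Hh|apply Rmin_r]).
  apply (Rmult_lt_compat_l (Rabs K + 1)) in H2; [|lra].
  replace ((Rabs K + 1) * (eps / (Rabs K + 1))) with eps in H2 by (field; lra).
  pose proof (Cmod_ge_0 h). pose proof (Rle_abs K). nra.
Qed.

Lemma has_cderiv_ext (f g : C -> C) (z l : C) :
  (forall w, f w = g w) -> has_cderiv f z l -> has_cderiv g z l.
Proof.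
  intros E H eps He. destruct (H eps He) as [d [d0 Hd]]. exists d. split; [exact d0|].
  intros h Hh. rewrite <- !E. exact (Hd h Hh).
Qed.

Lemma has_cderiv_affine (c l z : C) : has_cderiv (fun w => c + l * w)%C z l.
Proof.
  apply (has_cderiv_quadratic _ _ _ 0 1); [lra|]. intros h _.
  replace (c + l * (z + h) - (c + l * z) - l * h)%C with (RtoC 0) by ring.
  rewrite Cmod_0. lra.
Qed.

Lemma has_cderiv_mul (f g : C -> C) (z l m : C) :
  has_cderiv f z l -> has_cderiv g z m ->
  has_cderiv (fun w => f w * g w)%C z (l * g z + f z * m)%C.
Proof.
  intros Hf Hg eps He.
  destruct (has_cderiv_lip _ _ _ Hf) as [d1 [d10 H1]].
  destruct (has_cderiv_lip _ _ _ Hg) as [d2 [d20 H2]].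
  pose proof (Cmod_ge_0 (f z)) as F0. pose proof (Cmod_ge_0 (g z)) as G0.
  pose proof (Cmod_ge_0 l) as L0. pose proof (Cmod_ge_0 m) as M0.
  (* Half of [eps] pays for the two first-order remainders, multiplied by f z and g z (through [S]);
     the other half pays for the product of the two increments, which is of size T |h|^2. *)
  set (S := Cmod (f z) + Cmod (g z) + 1).
  assert (HS : 0 < eps / (2 * S)) by (apply Rdiv_lt_0_compat; unfold S; lra).
  destruct (Hf _ HS) as [d3 [d30 H3]]. destruct (Hg _ HS) as [d4 [d40 H4]].
  set (T := (Cmod l + 1) * (Cmod m + 1)).
  assert (T0 : 0 < T) by (unfold T; nra).
  assert (HT : 0 < eps / (2 * T)) by (apply Rdiv_lt_0_compat; lra).
  exists (Rmin (Rmin d1 d2) (Rmin (Rmin d3 d4) (eps / (2 * T)))).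
  split; [repeat apply Rmin_pos; assumption|].
  intros h Hh. change (Cmod h < Rmin (Rmin d1 d2) (Rmin (Rmin d3 d4) (eps / (2 * T)))) in Hh.
  apply Rmin_Rgt_l in Hh. destruct Hh as [Ha Hb].
  apply Rmin_Rgt_l in Ha. destruct Ha as [Ha1 Ha2].
  apply Rmin_Rgt_l in Hb. destruct Hb as [Hb Hb3].
  apply Rmin_Rgt_l in Hb. destruct Hb as [Hb1 Hb2].
  specialize (H1 h Ha1). specialize (H2 h Ha2). specialize (H3 h Hb1). specialize (H4 h Hb2).
  change (Cmod (f (z + h) - f z - l * h)%C <= eps / (2 * S) * Cmod h) in H3.
  change (Cmod (g (z + h) - g z - m * h)%C <= eps / (2 * S) * Cmod h) in H4.
  change (Cmod (f (z + h) * g (z + h) - f z * g z - (l * g z + f z * m) * h)%C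
          <= eps * Cmod h).
  replace (f (z + h) * g (z + h) - f z * g z - (l * g z + f z * m) * h)%C with
    ((f (z + h) - f z - l * h) * g z + f z * (g (z + h) - g z - m * h)
     + (f (z + h) - f z) * (g (z + h) - g z))%C by ring.
  eapply Rle_trans; [apply Cmod_triangle|].
  eapply Rle_trans; [apply Rplus_le_compat_r, Cmod_triangle|]. rewrite !Cmod_mult.
  pose proof (Cmod_ge_0 h) as h0.
  assert (A1 : Cmod (f (z + h) - f z - l * h)%C * Cmod (g z)
               <= eps / (2 * S) * Cmod h * Cmod (g z)) by (apply Rmult_le_compat_r; assumption).
  assert (A2 : Cmod (f z) * Cmod (g (z + h) - g z - m * h)%C
               <= Cmod (f z) * (eps / (2 * S) * Cmod h)) by (apply Rmult_le_compat_l; assumption).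
  assert (A3 : Cmod (f (z + h) - f z)%C * Cmod (g (z + h) - g z)%C
               <= ((Cmod l + 1) * Cmod h) * ((Cmod m + 1) * Cmod h))
    by (apply Rmult_le_compat; try apply Cmod_ge_0; assumption).
  replace (((Cmod l + 1) * Cmod h) * ((Cmod m + 1) * Cmod h)) with (T * Cmod h * Cmod h) in A3
    by (unfold T; ring).
  assert (A4 : T * Cmod h <= eps / 2).
  { replace (eps / 2) with (T * (eps / (2 * T))) by (field; lra). nra. }
  assert (A5 : eps / (2 * S) * (Cmod (f z) + Cmod (g z)) <= eps / 2).
  { replace (eps / 2) with (eps / (2 * S) * S) by (unfold S; field; lra). unfold S in *. nra. }
  nra.
Qed.

Lemma has_cderiv_add (f g : C -> C) (z l m : C) :
  has_cderiv f z l -> has_cderiv g z m -> has_cderiv (fun w => f w + g w)%C z (l + m)%C.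
Proof.
  intros Hf Hg eps He. assert (He2 : 0 < eps / 2) by lra.
  destruct (Hf _ He2) as [d1 [d10 H1]]. destruct (Hg _ He2) as [d2 [d20 H2]].
  exists (Rmin d1 d2). split; [apply Rmin_pos; assumption|].
  intros h Hh. apply Rmin_Rgt_l in Hh. destruct Hh as [Ha Hb].
  specialize (H1 h Ha). specialize (H2 h Hb).
  change (Cmod (f (z + h) - f z - l * h)%C <= eps / 2 * Cmod h) in H1.
  change (Cmod (g (z + h) - g z - m * h)%C <= eps / 2 * Cmod h) in H2.
  change (Cmod (f (z + h) + g (z + h) - (f z + g z) - (l + m) * h)%C <= eps * Cmod h).
  replace (f (z + h) + g (z + h) - (f z + g z) - (l + m) * h)%C with
    ((f (z + h) - f z - l * h) + (g (z + h) - g z - m * h))%C by ring.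
  eapply Rle_trans; [apply Cmod_triangle|]. lra.
Qed.

Lemma has_cderiv_scal (f : C -> C) (c z l : C) :
  has_cderiv f z l -> has_cderiv (fun w => c * f w)%C z (c * l)%C.
Proof.
  intros H. replace (c * l)%C with (0 * f z + c * l)%C by ring.
  apply (has_cderiv_mul (fun _ => c)); [|exact H].
  apply (has_cderiv_ext (fun w => c + 0 * w)%C); [intros; ring|apply has_cderiv_affine].
Qed.

Lemma has_cderiv_sub (f g : C -> C) (z l m : C) :
  has_cderiv f z l -> has_cderiv g z m -> has_cderiv (fun w => f w - g w)%C z (l - m)%C.
Proof.
  intros Hf Hg. replace (l - m)%C with (l + (- (1)) * m)%C by ring.
  apply (has_cderiv_ext (fun w => f w + (- (1)) * g w)%C); [intros; ring|].
  apply has_cderiv_add; [exact Hf|]. apply has_cderiv_scal, Hg.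
Qed.

Lemma has_cderiv_comp_affine (f : C -> C) (c d z l : C) : d <> 0 ->
  has_cderiv f (c + d * z)%C l -> has_cderiv (fun w => f (c + d * w)%C) z (d * l)%C.
Proof.
  intros Hd H eps He. apply Cmod_gt_0 in Hd.
  destruct (H (eps / Cmod d)) as [e [e0 Hb]]; [apply Rdiv_lt_0_compat; assumption|].
  exists (e / Cmod d). split; [apply Rdiv_lt_0_compat; assumption|].
  intros h Hh. change (Cmod h < e / Cmod d) in Hh.
  change (Cmod (f (c + d * (z + h)) - f (c + d * z) - d * l * h)%C <= eps * Cmod h).
  assert (Hm : Cmod (d * h)%C < e).
  { rewrite Cmod_mult. apply (Rmult_lt_compat_l (Cmod d)) in Hh; [|exact Hd].
    replace (Cmod d * (e / Cmod d)) with e in Hh by (field; lra). exact Hh. }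
  specialize (Hb _ Hm).
  change (Cmod (f (c + d * z + d * h) - f (c + d * z) - l * (d * h))%C
    <= eps / Cmod d * Cmod (d * h)%C) in Hb.
  rewrite Cmod_mult in Hb.
  replace (eps / Cmod d * (Cmod d * Cmod h)) with (eps * Cmod h) in Hb by (field; lra).
  replace (c + d * (z + h))%C with (c + d * z + d * h)%C by ring.
  replace (d * l * h)%C with (l * (d * h))%C by ring. exact Hb.
Qed.

(** The remainder is exactly h^2 / (z^2 (z + h)), and |h| < |z| / 2 keeps the last factor at least
    |z| / 2. *)
Lemma has_cderiv_inv (z : C) : z <> 0 -> has_cderiv Cinv z (- / (z * z))%C.
Proof.
  intros Hz. pose proof (proj1 (Cmod_gt_0 z) Hz) as z0.
  apply (has_cderiv_quadratic _ _ _ (2 / Cmod z ^ 3) (Cmod z / 2)); [lra|].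
  intros h Hh.
  assert (Hzh : Cmod z / 2 <= Cmod (z + h)%C).
  { replace (z + h)%C with (z - (- h))%C by ring.
    pose proof (Cmod_sub_ge z (- h)) as T. rewrite Cmod_opp in T. lra. }
  assert (Hn : (z + h)%C <> 0) by (apply Cmod_gt_0; lra).
  replace (/ (z + h) - / z - - / (z * z) * h)%C with (h * h * / (z * z * (z + h)))%C
    by (field; split; assumption).
  rewrite !Cmod_mult, Cmod_inv by (repeat apply Cmult_neq_0; assumption).
  rewrite !Cmod_mult.
  replace (2 / Cmod z ^ 3 * Cmod h ^ 2)
    with (Cmod h * Cmod h * / (Cmod z * Cmod z * (Cmod z / 2))) by (field; lra).
  apply Rmult_le_compat_l; [pose proof (Cmod_ge_0 h); nra|].
  apply Rinv_le_contravar; [apply Rmult_lt_0_compat; nra|].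
  apply Rmult_le_compat_l; nra.
Qed.

Lemma has_cderiv_pow (f : C -> C) (z l : C) (n : nat) :
  has_cderiv f z l -> exists l', has_cderiv (fun w => f w ^ n)%C z l'.
Proof.
  intros H. induction n as [|n [l' IH]].
  - exists (RtoC 0). apply (has_cderiv_ext (fun w => 1 + 0 * w)%C); [intros; simpl; ring|].
    apply has_cderiv_affine.
  - eexists. exact (has_cderiv_mul f (fun w => f w ^ n)%C _ _ _ H IH).
Qed.

Lemma has_cderiv_unique (f : C -> C) (z l m : C) :
  has_cderiv f z l -> has_cderiv f z m -> l = m.
Proof.
  intros H1 H2. apply NNPP. intros Hn.
  assert (Hp : 0 < Cmod (l - m)%C).
  { apply Cmod_gt_0. intros E. apply Hn. replace l with (l - m + m)%C by ring. rewrite E. ring. }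
  assert (Hp4 : 0 < Cmod (l - m)%C / 4) by lra.
  destruct (H1 _ Hp4) as [d1 [d10 K1]]. destruct (H2 _ Hp4) as [d2 [d20 K2]].
  set (r := Rmin d1 d2 / 2).
  assert (Hr : 0 < Rmin d1 d2) by (apply Rmin_pos; assumption).
  pose proof (Rmin_l d1 d2). pose proof (Rmin_r d1 d2).
  assert (Er : Cmod (RtoC r) = r) by (rewrite Cmod_R; apply Rabs_pos_eq; unfold r; lra).
  assert (A1 : Cmod (RtoC r) < d1) by (rewrite Er; unfold r; lra).
  assert (A2 : Cmod (RtoC r) < d2) by (rewrite Er; unfold r; lra).
  specialize (K1 _ A1). specialize (K2 _ A2).
  change (Cmod (f (z + r) - f z - l * r)%C <= Cmod (l - m)%C / 4 * Cmod r) in K1.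
  change (Cmod (f (z + r) - f z - m * r)%C <= Cmod (l - m)%C / 4 * Cmod r) in K2.
  rewrite Er in K1, K2.
  pose proof (Cmod_sub_le (f (z + r) - f z - m * r)%C (f (z + r) - f z - l * r)%C) as T.
  replace (f (z + r) - f z - m * r - (f (z + r) - f z - l * r))%C with ((l - m) * r)%C in T by ring.
  rewrite Cmod_mult, Er in T. assert (0 < r) by (unfold r; lra). nra.
Qed.

(* A square makes the quotient differentiable at the pole itself, so no
   exceptional point has to be treated in the contour argument. *)
Lemma has_cderiv_sqr_div (u : C -> C) (l : C) : u 0%C = 0%C -> has_cderiv u (RtoC 0) l ->
  has_cderiv (fun s => u s * u s * / s)%C (RtoC 0) (l * l)%C.
Proof.
  intros u0 H eps He.
  pose proof (Cmod_ge_0 l) as l0.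
  (* With r = u h - l h and |r| <= e |h|, the remainder is r (r + 2 l h) / h. The bound e <= 1
     controls the second factor by (2 |l| + 1) |h|, and the other bound on [e] makes the product at
     most eps |h|. *)
  set (e := Rmin 1 (eps / (2 * Cmod l + 1))).
  assert (e0 : 0 < e) by (apply Rmin_pos; [lra|apply Rdiv_lt_0_compat; lra]).
  assert (e1 : e <= 1) by apply Rmin_l.
  assert (e2 : e * (2 * Cmod l + 1) <= eps).
  { replace eps with (eps / (2 * Cmod l + 1) * (2 * Cmod l + 1)) by (field; lra).
    apply Rmult_le_compat_r; [lra|apply Rmin_r]. }
  destruct (H e e0) as [d [d0 Hd]]. exists d. split; [exact d0|].
  intros h Hh. specialize (Hd h Hh).
  change (Cmod (u (0 + h) - u 0 - l * h)%C <= e * Cmod h) in Hd.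
  change (Cmod (u (0 + h) * u (0 + h) * / (0 + h) - u 0 * u 0 * / 0 - l * l * h)%C <= eps * Cmod h).
  rewrite u0 in *. rewrite Cplus_0_l in *.
  destruct (classic (h = RtoC 0)) as [->|Hn].
  { rewrite u0. replace (0 * 0 * / 0 - 0 * 0 * / 0 - l * l * 0)%C with (RtoC 0) by ring.
    rewrite Cmod_0. lra. }
  replace (u h * u h * / h - 0 * 0 * / 0 - l * l * h)%C
    with ((u h - 0 - l * h) * ((u h - 0 - l * h) + 2 * l * h) * / h)%C
    by (replace (0 * 0 * / 0)%C with (RtoC 0) by ring; field; exact Hn).
  pose proof (proj1 (Cmod_gt_0 h) Hn) as h0.
  rewrite !Cmod_mult, Cmod_inv by exact Hn.
  assert (A : Cmod (u h - 0 - l * h + 2 * l * h)%C <= (2 * Cmod l + 1) * Cmod h).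
  { eapply Rle_trans; [apply Cmod_triangle|]. rewrite !Cmod_mult, Cmod_R.
    rewrite (Rabs_pos_eq 2) by lra. nra. }
  apply (Rmult_le_reg_r (Cmod h)); [exact h0|].
  rewrite Rmult_assoc, Rinv_l, Rmult_1_r by lra.
  eapply Rle_trans; [apply Rmult_le_compat; try apply Cmod_ge_0; eassumption|]. nra.
Qed.

(** * Bisection of intervals and rectangles *)

Lemma nested_intervals (a b : nat -> R) :
  (forall n, a n <= a (S n)) -> (forall n, b (S n) <= b n) -> (forall n, a n <= b n) ->
  exists p, forall n, a n <= p <= b n.
Proof.
  intros Ha Hb Hab.
  assert (Ma : forall k n, a n <= a (n + k)%nat).
  { induction k; intros n; [rewrite Nat.add_0_r; lra|].
    rewrite Nat.add_succ_r. eapply Rle_trans; [apply IHk|apply Ha]. }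
  assert (Mb : forall k n, b (n + k)%nat <= b n).
  { induction k; intros n; [rewrite Nat.add_0_r; lra|].
    rewrite Nat.add_succ_r. eapply Rle_trans; [apply Hb|apply IHk]. }
  assert (Mab : forall m n, a m <= b n).
  { intros m n. apply Rle_trans with (a (m + n)%nat); [apply Ma|].
    apply Rle_trans with (b (m + n)%nat); [apply Hab|]. rewrite Nat.add_comm. apply Mb. }
  destruct (completeness (fun x => exists n, x = a n)) as [p [Hp1 Hp2]].
  - exists (b O). intros x [n ->]. apply Mab.
  - exists (a O), O. reflexivity.
  - exists p. intros n. split.
    + apply Hp1. exists n. reflexivity.
    + apply Hp2. intros x [m ->]. apply Mab.
Qed.

(** [Bad x y r] speaks of the box with lower left corner (x, y) and sides r w and r h. Badness is
    inherited by some half-size child, and the nested boxes shrink to a point. A zero side is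
    allowed, so that the same lemma also bisects intervals. *)
Lemma box_bisection (Bad : R -> R -> R -> Prop) (w h x0 y0 : R) :
  0 <= w -> 0 <= h -> Bad x0 y0 1 ->
  (forall x y r, 0 < r -> x0 <= x -> x + r * w <= x0 + w -> y0 <= y -> y + r * h <= y0 + h ->
     Bad x y r ->
     exists x' y', (x' = x \/ x' = x + r / 2 * w) /\ (y' = y \/ y' = y + r / 2 * h) /\
       Bad x' y' (r / 2)) ->
  exists px py, x0 <= px <= x0 + w /\ y0 <= py <= y0 + h /\
    forall d, 0 < d -> exists x y r, Bad x y r /\ 0 < r < d /\
      x <= px <= x + r * w /\ y <= py <= y + r * h /\
      x0 <= x /\ x + r * w <= x0 + w /\ y0 <= y /\ y + r * h <= y0 + h.
Proof.
  intros Hw Hh H0 Hstep.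
  set (rr := fun n : nat => (/ 2) ^ n).
  assert (rpos : forall n, 0 < rr n) by (intros n; apply pow_lt; lra).
  assert (rS : forall n, rr (S n) = rr n / 2) by (intros n; unfold rr; simpl; lra).
  set (Inv := fun n (p : R * R) => Bad (fst p) (snd p) (rr n) /\ x0 <= fst p /\
     fst p + rr n * w <= x0 + w /\ y0 <= snd p /\ snd p + rr n * h <= y0 + h).
  set (Nxt := fun n (p p' : R * R) => fst p <= fst p' /\
     fst p' + rr (S n) * w <= fst p + rr n * w /\ snd p <= snd p' /\
     snd p' + rr (S n) * h <= snd p + rr n * h).
  (* The invariant is a premise inside the existential, so that choice yields a successor map
     defined on all pairs. *)
  assert (HN : forall n p, exists p', Inv n p -> Inv (S n) p' /\ Nxt n p p').
  { intros n p. destruct (classic (Inv n p)) as [HI|HI]; [|exists p; tauto].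
    destruct HI as (HB & I1 & I2 & I3 & I4). pose proof (rpos n) as rp.
    destruct (Hstep _ _ _ rp I1 I2 I3 I4 HB) as (x' & y' & Hx & Hy & HB').
    exists (x', y'). intros _. unfold Inv, Nxt. simpl fst; simpl snd. rewrite rS.
    assert (0 <= rr n / 2 * w) by nra. assert (0 <= rr n / 2 * h) by nra.
    replace (rr n * w) with (rr n / 2 * w + rr n / 2 * w) in * by field.
    replace (rr n * h) with (rr n / 2 * h + rr n / 2 * h) in * by field.
    repeat split; try assumption; destruct Hx; destruct Hy; subst; lra. }
  set (F := fun n p => proj1_sig (constructive_indefinite_description _ (HN n p))).
  assert (HF : forall n p, Inv n p -> Inv (S n) (F n p) /\ Nxt n p (F n p)).
  { intros n p. unfold F. destruct (constructive_indefinite_description _ (HN n p)); auto. }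
  set (u := nat_rect (fun _ => (R * R)%type) (x0, y0) F).
  assert (HI : forall n, Inv n (u n)).
  { induction n as [|n IH]; [|exact (proj1 (HF n _ IH))].
    unfold Inv, rr; simpl. repeat split; try assumption; lra. }
  assert (HX : forall n, Nxt n (u n) (u (S n))) by (intros n; exact (proj2 (HF n _ (HI n)))).
  destruct (nested_intervals (fun n => fst (u n)) (fun n => fst (u n) + rr n * w)) as [px Hpx].
  1,2: intros n; apply HX.
  { intros n. pose proof (rpos n). nra. }
  destruct (nested_intervals (fun n => snd (u n)) (fun n => snd (u n) + rr n * h)) as [py Hpy].
  1,2: intros n; apply HX.
  { intros n. pose proof (rpos n). nra. }
  exists px, py. split; [|split].
  - pose proof (Hpx O) as T. unfold rr in T; simpl in T. lra.
  - pose proof (Hpy O) as T. unfold rr in T; simpl in T. lra.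
  - intros d Hd. destruct (pow_lt_1_zero (/ 2)) with (y := d) as [N HNd]; [rewrite Rabs_pos_eq; lra|exact Hd|].
    specialize (HNd N (le_n _)). rewrite Rabs_pos_eq in HNd by (left; apply rpos).
    exists (fst (u N)), (snd (u N)), (rr N).
    destruct (HI N) as (B1 & B2 & B3 & B4 & B5).
    repeat split; try assumption; try apply Hpx; try apply Hpy; apply rpos.
Qed.

(** Cousin's lemma: if the claim failed on [s, t], bisection (with boxes of height 0) would give
    arbitrarily short bad intervals around one point, against the local hypothesis there. Locally
    only intervals containing that point have to be handled. *)
Lemma interval_local_to_global (ok : R -> R -> Prop) (s t : R) : s < t ->
  (forall p q r, s <= p -> p < q -> q < r -> r <= t -> ok p q -> ok q r -> ok p r) ->
  (forall a, s <= a <= t -> exists d, 0 < d /\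
     forall p q, s <= p <= a -> a <= q <= t -> p < q -> q - p < d -> ok p q) ->
  ok s t.
Proof.
  intros Hst Hadd Hloc. apply NNPP. intros Hbad.
  destruct (box_bisection (fun x _ r => ~ ok x (x + r * (t - s))) (t - s) 0 s 0)
    as (px & py & Hpx & _ & Hp); try lra.
  - replace (s + 1 * (t - s)) with t by ring. exact Hbad.
  - intros x y r Hr Hx1 Hx2 _ _ HB.
    assert (0 < r * (t - s)) by nra.
    replace (r * (t - s)) with (r / 2 * (t - s) + r / 2 * (t - s)) in * by field.
    destruct (classic (ok x (x + r / 2 * (t - s)))) as [H1|H1].
    + exists (x + r / 2 * (t - s)), y. repeat split; try (right; reflexivity); try (left; reflexivity).
      intros H2. apply HB. apply (Hadd _ (x + r / 2 * (t - s))); try assumption; try lra.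
      replace (x + (r / 2 * (t - s) + r / 2 * (t - s))) with
        (x + r / 2 * (t - s) + r / 2 * (t - s)) by ring. exact H2.
    + exists x, y. repeat split; try (left; reflexivity). exact H1.
  - destruct (Hloc px) as (d & d0 & Hd); [lra|].
    destruct (Hp (d / (t - s))) as (x & y & r & HB & Hr & Hpxx & _ & H1 & H2 & _ & _).
    { apply Rdiv_lt_0_compat; lra. }
    apply HB. assert (0 < r * (t - s)) by nra.
    apply Hd; try lra.
    replace (x + r * (t - s) - x) with (r * (t - s)) by ring.
    replace d with (d / (t - s) * (t - s)) by (field; lra). apply Rmult_lt_compat_r; lra.
Qed.

(** * Step functions below the vertical supremum *)

(** A lower bound for the supremum over a vertical line, phrased so that the supremum may be
    infinite. *)
Definition sup_ge (df : C -> C) (a c : R) : Prop :=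
  forall c', c' < c -> exists b, c' < Cmod (df (a, b)).

(** The relational form of [step_below] with its sum: endpoints and value are indices, so that
    concatenation, splitting and rescaling become inductions instead of manipulations of node
    sequences. *)
Inductive lower_step (df : C -> C) (s : R) : R -> R -> Prop :=
| lower_step_nil : 0 < s -> lower_step df s s 0
| lower_step_snoc t u v c : lower_step df s t v -> t < u ->
    (forall a, t <= a <= u -> sup_ge df a c) -> lower_step df s u (v + c * (u - t)).

Lemma lower_step_pos df s t v : lower_step df s t v -> 0 < s <= t.
Proof. induction 1; lra. Qed.

Lemma lower_step_value df s t v v' : v = v' -> lower_step df s t v -> lower_step df s t v'.
Proof. intros ->. exact (fun H => H). Qed.

Lemma lower_step_single df s t c : 0 < s -> s < t ->
  (forall a, s <= a <= t -> sup_ge df a c) -> lower_step df s t (c * (t - s)).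
Proof.
  intros. apply (lower_step_value df s t (0 + c * (t - s))); [ring|].
  apply lower_step_snoc; [apply lower_step_nil|..]; assumption.
Qed.

Lemma lower_step_app df s t u v1 v2 :
  lower_step df s t v1 -> lower_step df t u v2 -> lower_step df s u (v1 + v2).
Proof.
  intros H1. induction 1 as [|t' u v c _ IH Hlt Hc].
  - apply (lower_step_value df s t v1); [ring|exact H1].
  - apply (lower_step_value df s u ((v1 + v) + c * (u - t'))); [ring|].
    apply lower_step_snoc; assumption.
Qed.

Lemma lower_step_split df s t v p : lower_step df s t v -> s <= p <= t ->
  exists v1 v2, lower_step df s p v1 /\ lower_step df p t v2 /\ v = v1 + v2.
Proof.
  induction 1 as [s0|t u v c H IH Hlt Hc]; intros Hp.
  - exists 0, 0. replace p with s by lra. repeat split; try (apply lower_step_nil; assumption). ring.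
  - destruct (Rle_dec p t) as [Hpt|Hpt].
    + destruct IH as (v1 & v2 & H1 & H2 & E); [lra|].
      exists v1, (v2 + c * (u - t)). repeat split; [exact H1| |lra].
      apply lower_step_snoc; assumption.
    + exists (v + c * (p - t)).
      destruct (Rle_lt_or_eq_dec p u) as [Hpu|Hpu]; [lra| |].
      * exists (c * (u - p)). split; [|split; [|ring]].
        -- apply lower_step_snoc; [exact H|lra|]. intros; apply Hc; lra.
        -- apply lower_step_single; [pose proof (lower_step_pos _ _ _ _ H); lra|lra|].
           intros; apply Hc; lra.
      * subst p. exists 0. split; [|split; [|ring]].
        -- apply lower_step_snoc; assumption.
        -- apply lower_step_nil. pose proof (lower_step_pos _ _ _ _ H); lra.
Qed.

(** Transfers lower sums between m' and m' f on a strip where |f| is bounded below by a constant;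
    this is how integrability of m' f limits m'. *)
Lemma lower_step_scale df dg s t v k : 0 < k -> lower_step df s t v ->
  (forall a b, s <= a <= t -> k * Cmod (df (a, b)) <= Cmod (dg (a, b))) ->
  lower_step dg s t (k * v).
Proof.
  intros Hk. induction 1 as [s0|t u v c H IH Hlt Hc]; intros Hle.
  - apply (lower_step_value dg s s 0); [ring|]. apply lower_step_nil. assumption.
  - apply (lower_step_value dg s u (k * v + (k * c) * (u - t))); [ring|].
    pose proof (lower_step_pos _ _ _ _ H).
    apply lower_step_snoc; [apply IH; intros; apply Hle; lra|exact Hlt|].
    intros a Ha c' Hc'. destruct (Hc a Ha (c' / k)) as [b Hb].
    { apply (Rmult_lt_reg_r k); [exact Hk|]. replace (c' / k * k) with c' by (field; lra). lra. }
    exists b. apply Rlt_le_trans with (k * Cmod (df (a, b))); [|apply Hle; lra].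
    apply (Rmult_lt_compat_l k) in Hb; [|exact Hk].
    replace (k * (c' / k)) with c' in Hb by (field; lra). exact Hb.
Qed.

Lemma lower_step_of_step_below df k x c : step_below df k x c ->
  lower_step df (x O) (x k) (step_sum k x c).
Proof.
  induction k as [|k IH]; intros (H0 & Hx & Hc).
  - apply lower_step_nil, H0.
  - apply lower_step_snoc.
    + apply IH. split; [exact H0|]. split; intros; [apply Hx; lia|].
      apply Hc with i; [lia|assumption..].
    + apply Hx; lia.
    + exact (Hc k (Nat.lt_succ_diag_r k)).
Qed.

Lemma step_sum_ext k x c x' c' : (forall i, (i <= k)%nat -> x i = x' i) ->
  (forall i, (i < k)%nat -> c i = c' i) -> step_sum k x c = step_sum k x' c'.
Proof.
  induction k as [|k IH]; intros Hx Hc; [reflexivity|].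
  simpl. rewrite IH by (intros; first [apply Hx; lia|apply Hc; lia]).
  rewrite (Hx k), (Hx (S k)), Hc by lia. reflexivity.
Qed.

Lemma step_below_of_lower_step df s t v : lower_step df s t v ->
  exists k x c, step_below df k x c /\ x O = s /\ x k = t /\ step_sum k x c = v.
Proof.
  induction 1 as [s0|t u v c0 H IH Hlt Hc].
  - exists O, (fun _ => s), (fun _ => 0). split; [|auto].
    split; [assumption|]. split; intros; lia.
  - destruct IH as (k & x & c & (S1 & S2 & S3) & X0 & Xk & Sv).
    set (x' := fun i => if le_lt_dec i k then x i else u).
    set (c' := fun i => if Nat.eq_dec i k then c0 else c i).
    assert (Ex : forall i, (i <= k)%nat -> x' i = x i)
      by (intros i Hi; unfold x'; destruct (le_lt_dec i k); [reflexivity|lia]).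
    assert (Ec : forall i, (i < k)%nat -> c' i = c i)
      by (intros i Hi; unfold c'; destruct (Nat.eq_dec i k); [lia|reflexivity]).
    assert (Exk : x' (S k) = u) by (unfold x'; destruct (le_lt_dec (S k) k); [lia|reflexivity]).
    assert (Eck : c' k = c0) by (unfold c'; destruct (Nat.eq_dec k k); [reflexivity|lia]).
    exists (S k), x', c'. split; [|split; [|split]].
    + split; [rewrite Ex by lia; exact S1|]. split.
      * intros i Hi. destruct (Nat.eq_dec i k) as [->|Hn].
        -- rewrite Exk, Ex, Xk by lia. exact Hlt.
        -- rewrite !Ex by lia. apply S2. lia.
      * intros i Hi. destruct (Nat.eq_dec i k) as [->|Hn].
        -- rewrite Exk, Ex, Xk, Eck by lia. exact Hc.
        -- rewrite !Ex, Ec by lia. apply S3. lia.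
    + rewrite Ex by lia. exact X0.
    + exact Exk.
    + simpl. rewrite Exk, Eck, Ex, Xk by lia. f_equal. rewrite <- Sv.
      apply step_sum_ext; assumption.
Qed.

Lemma B0int_le_iff df K :
  B0int_le df K <-> forall s t v, lower_step df s t v -> v <= K.
Proof.
  split.
  - intros H s t v Hv. destruct (step_below_of_lower_step _ _ _ _ Hv) as (k & x & c & Hs & _ & _ & <-).
    apply H, Hs.
  - intros H k x c Hs. exact (H _ _ _ (lower_step_of_step_below _ _ _ _ Hs)).
Qed.

(** * Mean value inequality, semicontinuity and subadditivity of the integral *)

Lemma is_derive_fst_real (g : C -> C) (t : R) (l : C) :
  has_cderiv g (RtoC t) l -> is_derive (fun x => fst (g (RtoC x))) t (fst l).
Proof.
  intros H. apply is_derive_Reals. intros eps He.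
  (* The real derivative asks for a strict inequality, the complex one gives a weak one. *)
  destruct (H (eps / 2)) as [d [d0 Hd]]; [lra|]. exists (mkposreal d d0).
  intros h Hh0 Hh. simpl in Hh.
  specialize (Hd (RtoC h)).
  change (Cmod h < d -> Cmod (g (t + h) - g t - l * h)%C <= eps / 2 * Cmod h) in Hd.
  rewrite Cmod_R in Hd. specialize (Hd Hh). rewrite <- RtoC_plus in Hd.
  pose proof (Rle_trans _ _ _ (fst_le_Cmod _) Hd) as T. simpl in T.
  replace (fst (g (RtoC (t + h))) + - fst (g (RtoC t)) + - (fst l * h - snd l * 0)) with
    (((fst (g (RtoC (t + h))) - fst (g (RtoC t))) / h - fst l) * h) in T by (field; exact Hh0).
  rewrite Rabs_mult in T. pose proof (Rabs_pos_lt h Hh0) as hp.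
  apply Rmult_le_reg_r in T; [|exact hp]. lra.
Qed.

(* Project onto the direction of the increment, so that the real mean value
   theorem applies. *)
Lemma mean_value_ineq (f df : C -> C) (z d : C) (k : R) : d <> 0 -> 0 < k ->
  (forall t, 0 <= t <= k -> has_cderiv f (z + d * t)%C (df (z + d * t)%C)) ->
  exists t, 0 <= t <= k /\
    Cmod (f (z + d * k) - f z)%C <= Cmod d * Cmod (df (z + d * t)%C) * k.
Proof.
  intros Hd Hk H. set (D := (f (z + d * k) - f z)%C).
  set (g := fun w : C => (Cconj D * f (z + d * w))%C).
  assert (Hg : forall t : R, 0 <= t <= k ->
    is_derive (fun x => fst (g (RtoC x))) t (fst (Cconj D * (d * df (z + d * t)))%C)).
  { intros t Ht. apply is_derive_fst_real. apply has_cderiv_scal.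
    apply has_cderiv_comp_affine; [exact Hd|]. apply H, Ht. }
  destruct (MVT_gen (fun x => fst (g (RtoC x))) 0 k
     (fun t => fst (Cconj D * (d * df (z + d * t)))%C)) as (t & Ht & E);
    rewrite ?Rmin_left, ?Rmax_right in * by lra.
  - intros x Hx. apply Hg. lra.
  - intros x Hx. apply continuity_pt_filterlim.
    apply (ex_derive_continuous (fun x => fst (g (RtoC x)))). eexists. apply Hg, Hx.
  - exists t. split; [exact Ht|].
    assert (E2 : fst (g (RtoC k)) - fst (g (RtoC 0)) = Cmod D ^ 2).
    { rewrite Cmod2_alt. unfold g. replace (z + d * 0)%C with z by ring.
      unfold D. destruct (f (z + d * k)%C) as [p1 p2]. destruct (f z) as [q1 q2].
      simpl. ring. }
    rewrite E2 in E. pose proof (Rle_abs (fst (Cconj D * (d * df (z + d * t)))%C)) as T.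
    pose proof (fst_le_Cmod (Cconj D * (d * df (z + d * t)))%C) as T2.
    rewrite !Cmod_mult, Cmod_conj in T2.
    pose proof (Cmod_ge_0 D) as D0. fold D.
    assert (T3 : Cmod D * Cmod D <= Cmod D * (Cmod d * Cmod (df (z + d * t)%C) * k)) by nra.
    destruct D0 as [D0|D0]; [exact (Rmult_le_reg_l _ _ _ D0 T3)|].
    rewrite <- D0. repeat apply Rmult_le_pos; try apply Cmod_ge_0; lra.
Qed.

(** The increment is taken across the point, not from it, since a bisection interval merely contains
    its limit point. *)
Lemma has_cderiv_straddle (f : C -> C) (z l : C) (eps : R) :
  has_cderiv f z l -> 0 < eps -> exists d, 0 < d /\ forall p q, 0 <= p < d -> 0 <= q < d ->
    Cmod (f (z + RtoC q) - f (z + RtoC (- p)))%C <= (Cmod l + eps) * (p + q).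
Proof.
  intros H He. destruct (H eps He) as [d [d0 Hd]]. exists d. split; [exact d0|].
  intros p q Hp Hq.
  assert (Ep : Cmod (RtoC (- p)) = p) by (rewrite Cmod_R, Rabs_Ropp, Rabs_pos_eq; lra).
  assert (Eq : Cmod (RtoC q) = q) by (rewrite Cmod_R, Rabs_pos_eq; lra).
  assert (A1 : Cmod (f (z + RtoC (- p)) - f z - l * RtoC (- p))%C <= eps * Cmod (RtoC (- p)))
    by (apply Hd; change (Cmod (RtoC (- p)) < d); lra).
  assert (A2 : Cmod (f (z + RtoC q) - f z - l * RtoC q)%C <= eps * Cmod (RtoC q))
    by (apply Hd; change (Cmod (RtoC q) < d); lra).
  replace (f (z + RtoC q) - f (z + RtoC (- p)))%C with
    ((f (z + RtoC q) - f z - l * RtoC q) - (f (z + RtoC (- p)) - f z - l * RtoC (- p))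
      + l * RtoC (p + q))%C by (rewrite RtoC_plus, RtoC_opp; ring).
  eapply Rle_trans; [apply Cmod_triangle|].
  eapply Rle_trans; [apply Rplus_le_compat_r, Cmod_sub_le|].
  rewrite Cmod_mult, (Cmod_R (p + q)), (Rabs_pos_eq (p + q)) by lra. nra.
Qed.

(* The vertical supremum of |f'| is the Lipschitz constant of f on the line, a
   supremum of functions continuous in the abscissa; no continuity of f' is needed. *)
Lemma sup_lower_semicontinuous (f df : C -> C) (a b eps : R) :
  holo_on_Cplus f df -> 0 < a -> 0 < eps ->
  exists d, 0 < d /\ forall a', Rabs (a' - a) < d -> sup_ge df a' (Cmod (df (a, b)) - eps).
Proof.
  intros H Ha He. set (l := df (a, b)).
  assert (Hab : forall y, has_cderiv f (a, y) (df (a, y))) by (intros y; apply H; exact Ha).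
  destruct (Hab b (eps / 2)) as [d [d0 Hd]]; [lra|].
  set (k := d / 2). assert (k0 : 0 < k) by (unfold k; lra).
  assert (Ek : Cmod (Ci * RtoC k)%C = k)
    by (rewrite Cmod_mult, Cmod_Ci, Cmod_R, Rabs_pos_eq; lra).
  assert (V : forall x y t, ((x, y) + Ci * RtoC t)%C = (x, y + t))
    by (intros; unfold Cplus, Cmult, Ci, RtoC; simpl; f_equal; ring).
  assert (A1 : Cmod (f (a, (b + k)%R) - f (a, b) - l * (Ci * RtoC k))%C <= eps / 2 * k).
  { specialize (Hd (Ci * RtoC k)%C).
    change (Cmod (Ci * RtoC k)%C < d -> Cmod (f ((a, b) + Ci * RtoC k) - f (a, b)
       - l * (Ci * RtoC k))%C <= eps / 2 * Cmod (Ci * RtoC k)%C) in Hd.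
    rewrite V, Ek in Hd. apply Hd. unfold k; lra. }
  assert (A2 : (Cmod l - eps / 2) * k <= Cmod (f (a, (b + k)%R) - f (a, b))%C).
  { pose proof (Cmod_sub_ge (l * (Ci * RtoC k))%C (f (a, (b + k)%R) - f (a, b))%C) as T.
    rewrite (Cmod_sub_sym (l * (Ci * RtoC k))%C), Cmod_mult, Ek in T. lra. }
  (* The vertical step [k] is now fixed and only the abscissa moves. The secant loses eps/2 to
     differentiability at (a, b) and eps/8 at each end to the move, hence 3 eps/4 in all; the mean
     value inequality returns to a value of [df] on the new line. *)
  assert (e8 : 0 < eps / 8 * k) by nra.
  destruct (has_cderiv_continuous _ _ _ (Hab (b + k)) _ e8) as [d1 [d10 H1]].
  destruct (has_cderiv_continuous _ _ _ (Hab b) _ e8) as [d2 [d20 H2]].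
  exists (Rmin (Rmin d1 d2) a). split; [repeat apply Rmin_pos; assumption|].
  intros a' Ha'. apply Rmin_Rgt_l in Ha'. destruct Ha' as [Ha' Ha3].
  apply Rmin_Rgt_l in Ha'. destruct Ha' as [Ha1 Ha2].
  assert (Hor : forall y, ((a, y) + RtoC (a' - a))%C = (a', y))
    by (intros; unfold Cplus, RtoC; simpl; f_equal; ring).
  specialize (H1 (RtoC (a' - a))). specialize (H2 (RtoC (a' - a))).
  rewrite Cmod_R, Hor in H1, H2. specialize (H1 Ha1). specialize (H2 Ha2).
  assert (a'0 : 0 < a') by (apply Rabs_def2 in Ha3; lra).
  destruct (mean_value_ineq f df (a', b) Ci k) as (t & _ & Ht).
  { intros E. pose proof (f_equal snd E) as T. simpl in T. lra. }
  { exact k0. }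
  { intros t _. apply H. rewrite V. exact a'0. }
  rewrite !V, Cmod_Ci, Rmult_1_l in Ht.
  intros c' Hc'. exists (b + t).
  assert (A3 : Cmod (f (a, (b + k)%R) - f (a, b))%C <=
     Cmod (f (a', (b + k)%R) - f (a', b))%C + eps / 4 * k).
  { replace (f (a, (b + k)%R) - f (a, b))%C with
      ((f (a', (b + k)%R) - f (a', b)) - (f (a', (b + k)%R) - f (a, (b + k)%R)) + (f (a', b) - f (a, b)))%C by ring.
    eapply Rle_trans; [apply Cmod_triangle|].
    eapply Rle_trans; [apply Rplus_le_compat_r, Cmod_sub_le|]. lra. }
  apply Rlt_le_trans with (Cmod l - eps); [exact Hc'|].
  apply (Rmult_le_reg_r k); [exact k0|]. nra.
Qed.

(** Near an abscissa a, one ordinate b almost reaches the height of the given step. By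
    semicontinuity the constants |df1 (a, b)| and |df2 (a, b)|, slightly lowered, are admissible
    steps on a whole neighbourhood of a, and taking the same b for both lets the pointwise
    inequality apply. The pieces are glued by [interval_local_to_global]. *)
Lemma lower_step_combine (f1 f2 df1 df2 df : C -> C) (al be s t v eps : R) :
  holo_on_Cplus f1 df1 -> holo_on_Cplus f2 df2 -> 0 <= al -> 0 <= be -> 0 < eps ->
  (forall a b, 0 < a ->
     Cmod (df (a, b)) <= al * Cmod (df1 (a, b)) + be * Cmod (df2 (a, b))) ->
  lower_step df s t v ->
  exists v1 v2, lower_step df1 s t v1 /\ lower_step df2 s t v2 /\
    v <= al * v1 + be * v2 + eps * (t - s).
Proof.
  intros H1 H2 Hal Hbe He Hle. induction 1 as [s0|t u v c H IH Hlt Hc].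
  - exists 0, 0. split; [|split]; [apply lower_step_nil; assumption..|lra].
  - pose proof (lower_step_pos _ _ _ _ H) as Hpos.
    enough (HH : exists v1 v2, lower_step df1 t u v1 /\ lower_step df2 t u v2 /\
       c * (u - t) <= al * v1 + be * v2 + eps * (u - t)).
    { destruct IH as (v1 & v2 & L1 & L2 & L3). destruct HH as (w1 & w2 & M1 & M2 & M3).
      exists (v1 + w1), (v2 + w2). split; [|split].
      - exact (lower_step_app _ _ _ _ _ _ L1 M1).
      - exact (lower_step_app _ _ _ _ _ _ L2 M2).
      - nra. }
    apply (interval_local_to_global (fun p q => exists v1 v2, lower_step df1 p q v1 /\
       lower_step df2 p q v2 /\ c * (q - p) <= al * v1 + be * v2 + eps * (q - p))); [exact Hlt|..].
    + intros p q r _ _ _ _ (v1 & v2 & L1 & L2 & L3) (w1 & w2 & M1 & M2 & M3).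
      exists (v1 + w1), (v2 + w2). split; [|split].
      * exact (lower_step_app _ _ _ _ _ _ L1 M1).
      * exact (lower_step_app _ _ _ _ _ _ L2 M2).
      * nra.
    + intros a Ha. destruct (Hc a Ha (c - eps / 2)) as [b Hb]; [lra|].
      (* Lowering both heights by [eta] costs at most eps/2; the other eps/2 was spent on choosing
         b. *)
      set (eta := eps / (2 * (al + be + 1))).
      assert (eta0 : 0 < eta) by (apply Rdiv_lt_0_compat; lra).
      assert (a0 : 0 < a) by lra.
      destruct (sup_lower_semicontinuous f1 df1 a b eta H1 a0 eta0) as [d1 [d10 D1]].
      destruct (sup_lower_semicontinuous f2 df2 a b eta H2 a0 eta0) as [d2 [d20 D2]].
      exists (Rmin d1 d2). split; [apply Rmin_pos; assumption|].
      intros p q Hp Hq Hpq Hd. apply Rmin_Rgt_l in Hd. destruct Hd as [Hd1 Hd2].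
      exists ((Cmod (df1 (a, b)) - eta) * (q - p)), ((Cmod (df2 (a, b)) - eta) * (q - p)).
      split; [|split].
      * apply lower_step_single; [lra|exact Hpq|]. intros x Hx. apply D1.
        apply Rabs_def1; lra.
      * apply lower_step_single; [lra|exact Hpq|]. intros x Hx. apply D2.
        apply Rabs_def1; lra.
      * specialize (Hle a b a0).
        assert (E : eta * (al + be + 1) = eps / 2) by (unfold eta; field; lra).
        assert (G : c <= al * (Cmod (df1 (a, b)) - eta) + be * (Cmod (df2 (a, b)) - eta) + eps)
          by nra.
        apply (Rmult_le_compat_r (q - p)) in G; nra.
Qed.

(** [df] is any dominated function, because the lemma serves both the product rule, with df = (m
    f)', and its rearrangement, with df = m' f. *)
Lemma B0int_le_combine (f1 f2 df1 df2 df : C -> C) (al be K1 K2 : R) :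
  holo_on_Cplus f1 df1 -> holo_on_Cplus f2 df2 -> 0 <= al -> 0 <= be ->
  (forall a b, 0 < a ->
     Cmod (df (a, b)) <= al * Cmod (df1 (a, b)) + be * Cmod (df2 (a, b))) ->
  B0int_le df1 K1 -> B0int_le df2 K2 -> B0int_le df (al * K1 + be * K2).
Proof.
  intros H1 H2 Hal Hbe Hle I1 I2. apply B0int_le_iff. intros s t v Hv.
  pose proof (lower_step_pos _ _ _ _ Hv) as Hst.
  apply le_epsilon. intros eps He.
  (* The summand 1 keeps the divisor positive in the degenerate case s = t. *)
  destruct (lower_step_combine f1 f2 df1 df2 df al be s t v (eps / (t - s + 1)))
    as (v1 & v2 & L1 & L2 & L3); try assumption.
  { apply Rdiv_lt_0_compat; lra. }
  pose proof (proj1 (B0int_le_iff _ _) I1 _ _ _ L1).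
  pose proof (proj1 (B0int_le_iff _ _) I2 _ _ _ L2).
  assert (eps / (t - s + 1) * (t - s) <= eps).
  { replace eps with (eps / (t - s + 1) * (t - s + 1)) at 2 by (field; lra).
    apply Rmult_le_compat_l; [left; apply Rdiv_lt_0_compat|]; lra. }
  nra.
Qed.

(** Stands in for the fundamental theorem of calculus. Around each abscissa the increment is at most
    (|dh (a, b)| + e) times the length, while |dh (a, b)| - e is an admissible step there; the
    defect 2 e times the length is additive. *)
Lemma B0int_increment (h dh : C -> C) (K s t b : R) :
  holo_on_Cplus h dh -> B0int_le dh K -> 0 < s -> s < t ->
  Cmod (h (t, b) - h (s, b))%C <= K.
Proof.
  intros H I Hs Hst. apply le_epsilon. intros eps He.
  set (e := eps / (2 * (t - s))).
  assert (e0 : 0 < e) by (apply Rdiv_lt_0_compat; lra).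
  assert (HH : exists v, lower_step dh s t v /\
     Cmod (h (t, b) - h (s, b))%C <= v + 2 * e * (t - s)).
  { apply (interval_local_to_global (fun p q => exists v, lower_step dh p q v /\
       Cmod (h (q, b) - h (p, b))%C <= v + 2 * e * (q - p))); [exact Hst|..].
    - intros p q r _ _ _ _ (v1 & L1 & M1) (v2 & L2 & M2). exists (v1 + v2). split.
      + exact (lower_step_app _ _ _ _ _ _ L1 L2).
      + replace (h (r, b) - h (p, b))%C with
          ((h (r, b) - h (q, b)) + (h (q, b) - h (p, b)))%C by ring.
        eapply Rle_trans; [apply Cmod_triangle|]. lra.
    - intros a Ha. assert (a0 : 0 < a) by lra.
      destruct (sup_lower_semicontinuous h dh a b e H a0 e0) as [d1 [d10 D1]].
      destruct (has_cderiv_straddle h (a, b) (dh (a, b)) e) as [d2 [d20 D2]];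
        [apply H; exact a0|exact e0|].
      exists (Rmin d1 d2). split; [apply Rmin_pos; assumption|].
      intros p q Hp Hq Hpq Hd. apply Rmin_Rgt_l in Hd. destruct Hd as [Hd1 Hd2].
      exists ((Cmod (dh (a, b)) - e) * (q - p)). split.
      + apply lower_step_single; [lra|exact Hpq|]. intros x Hx. apply D1. apply Rabs_def1; lra.
      + specialize (D2 (a - p) (q - a)).
        replace ((a, b) + RtoC (q - a))%C with (q, b) in D2
          by (unfold Cplus, RtoC; simpl; f_equal; ring).
        replace ((a, b) + RtoC (- (a - p)))%C with (p, b) in D2
          by (unfold Cplus, RtoC; simpl; f_equal; ring).
        replace (a - p + (q - a)) with (q - p) in D2 by ring.
        eapply Rle_trans; [apply D2; lra|]. lra. }
  destruct HH as (v & L & M). pose proof (proj1 (B0int_le_iff _ _) I _ _ _ L).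
  replace (2 * e * (t - s)) with eps in M by (unfold e; field; lra). lra.
Qed.

(** Each step is at most a drop of G, by the mean value theorem, and the drops telescope. *)
Lemma B0int_le_of_antiderivative (df : C -> C) (G F : R -> R) (K : R) :
  (forall a, 0 < a -> is_derive G a (- F a)) ->
  (forall a b, 0 < a -> Cmod (df (a, b)) <= F a) ->
  (forall a, 0 < a -> 0 <= G a <= K) -> B0int_le df K.
Proof.
  intros HG HF HK. apply B0int_le_iff. intros s t v Hv.
  enough (E : v <= G s - G t).
  { pose proof (lower_step_pos _ _ _ _ Hv). pose proof (HK s). pose proof (HK t). lra. }
  induction Hv as [s0|t u v c H IH Hlt Hc]; [lra|].
  pose proof (lower_step_pos _ _ _ _ H).
  destruct (MVT_gen G t u (fun x => - F x)) as (x & Hx & E);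
    rewrite ?Rmin_left, ?Rmax_right in * by lra.
  - intros x Hx. apply HG. lra.
  - intros x Hx. apply continuity_pt_filterlim.
    apply (ex_derive_continuous G). eexists. apply HG. lra.
  - assert (c <= F x).
    { apply Rnot_lt_le. intros Hn. destruct (Hc x Hx _ Hn) as [b Hb].
      pose proof (HF x b). lra. }
    nra.
Qed.

Lemma continuous_of_increment (u : R -> R) (x : R) :
  (forall eps, 0 < eps -> exists d, 0 < d /\
     forall h, Rabs h < d -> Rabs (u (x + h) - u x) < eps) -> continuous u x.
Proof.
  intros H. apply filterlim_locally. intros eps.
  destruct (H eps (cond_pos eps)) as [d [d0 Hd]]. exists (mkposreal d d0).
  intros y Hy. specialize (Hd (y - x) Hy).
  rewrite Rplus_minus in Hd. exact Hd.
Qed.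

(** These are exactly the two coordinates that [circ] integrates along horizontal and vertical
    edges. *)
Lemma has_cderiv_continuous_coord (P : C -> C) (x y : R) (l : C) : has_cderiv P (x, y) l ->
  continuous (fun t => snd (P (t, y))) x /\ continuous (fun t => fst (P (x, t))) y.
Proof.
  intros H. split; apply continuous_of_increment; intros eps He;
    destruct (has_cderiv_continuous _ _ _ H eps He) as [d [d0 Hd]];
    exists d; (split; [exact d0|]); intros h Hh.
  - specialize (Hd (RtoC h)). rewrite Cmod_R in Hd.
    replace ((x, y) + RtoC h)%C with ((x + h)%R, y) in Hd
      by (unfold Cplus, RtoC; simpl; f_equal; ring).
    eapply Rle_lt_trans; [|exact (Hd Hh)]. apply (snd_le_Cmod (P ((x + h)%R, y) - P (x, y))%C).
  - specialize (Hd (Ci * RtoC h)%C). rewrite Cmod_mult, Cmod_Ci, Rmult_1_l, Cmod_R in Hd.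
    replace ((x, y) + Ci * RtoC h)%C with (x, (y + h)%R) in Hd
      by (unfold Cplus, RtoC, Cmult, Ci; simpl; f_equal; ring).
    eapply Rle_lt_trans; [|exact (Hd Hh)]. apply (fst_le_Cmod (P (x, (y + h)%R) - P (x, y))%C).
Qed.

Lemma RInt_near_const (u : R -> R) (a b c M : R) : a <= b -> ex_RInt u a b ->
  (forall t, a <= t <= b -> Rabs (u t - c) <= M) ->
  Rabs (RInt u a b - c * (b - a)) <= (b - a) * M.
Proof.
  intros Hab Hu HM.
  assert (E : RInt (fun t => u t - c) a b = RInt u a b - c * (b - a)).
  { rewrite (RInt_minus u (fun _ => c)); [|exact Hu|apply ex_RInt_const].
    rewrite RInt_const. unfold minus, plus, opp, scal; simpl. unfold mult; simpl. ring. }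
  rewrite <- E. apply abs_RInt_le_const; [exact Hab| |exact HM].
  apply (ex_RInt_minus u (fun _ => c)); [exact Hu|apply ex_RInt_const].
Qed.

(** * Goursat's theorem on rectangles and the maximum principle *)

(* The imaginary part of the integral of P dz around [x1,x2] x [y1,y2]. *)
Definition circ (P : C -> C) (x1 x2 y1 y2 : R) : R :=
  RInt (fun x => snd (P (x, y1)) - snd (P (x, y2))) x1 x2 +
  RInt (fun y => fst (P (x2, y)) - fst (P (x1, y))) y1 y2.

Definition cdiff_box (P : C -> C) (x1 x2 y1 y2 : R) : Prop :=
  forall x y, x1 <= x <= x2 -> y1 <= y <= y2 -> exists l, has_cderiv P (x, y) l.

Lemma ex_RInt_horizontal P X1 X2 Y1 Y2 a b y : cdiff_box P X1 X2 Y1 Y2 ->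
  X1 <= a -> a <= b -> b <= X2 -> Y1 <= y <= Y2 -> ex_RInt (fun x => snd (P (x, y))) a b.
Proof.
  intros H Ha Hab Hb Hy. apply (ex_RInt_continuous (fun x => snd (P (x, y)))). intros x Hx.
  rewrite Rmin_left, Rmax_right in Hx by lra.
  destruct (H x y) as [l Hl]; [lra|lra|]. apply (has_cderiv_continuous_coord _ _ _ _ Hl).
Qed.

Lemma ex_RInt_vertical P X1 X2 Y1 Y2 a b x : cdiff_box P X1 X2 Y1 Y2 ->
  Y1 <= a -> a <= b -> b <= Y2 -> X1 <= x <= X2 -> ex_RInt (fun y => fst (P (x, y))) a b.
Proof.
  intros H Ha Hab Hb Hx. apply (ex_RInt_continuous (fun y => fst (P (x, y)))). intros y Hy.
  rewrite Rmin_left, Rmax_right in Hy by lra.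
  destruct (H x y) as [l Hl]; [lra|lra|]. apply (has_cderiv_continuous_coord _ _ _ _ Hl).
Qed.

Lemma circ_split_x P x1 m x2 y1 y2 : cdiff_box P x1 x2 y1 y2 -> x1 <= m <= x2 -> y1 <= y2 ->
  circ P x1 x2 y1 y2 = circ P x1 m y1 y2 + circ P m x2 y1 y2.
Proof.
  intros H Hm Hy. unfold circ.
  assert (Hh : forall a b, x1 <= a -> a <= b -> b <= x2 ->
    ex_RInt (fun x => snd (P (x, y1)) - snd (P (x, y2))) a b).
  { intros a b Ha Hab Hb.
    apply (ex_RInt_minus (fun x => snd (P (x, y1))) (fun x => snd (P (x, y2))));
      eapply ex_RInt_horizontal; try eassumption; lra. }
  assert (Hv : forall c d, x1 <= c <= x2 -> x1 <= d <= x2 ->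
    ex_RInt (fun y => fst (P (c, y)) - fst (P (d, y))) y1 y2).
  { intros c d Hc Hd.
    apply (ex_RInt_minus (fun y => fst (P (c, y))) (fun y => fst (P (d, y))));
      eapply ex_RInt_vertical; try eassumption; lra. }
  rewrite <- (RInt_Chasles (fun x => snd (P (x, y1)) - snd (P (x, y2))) x1 m x2) by (apply Hh; lra).
  rewrite (RInt_ext (fun y => fst (P (x2, y)) - fst (P (x1, y)))
    (fun y => plus (fst (P (m, y)) - fst (P (x1, y))) (fst (P (x2, y)) - fst (P (m, y))))).
  2: { intros y _. unfold plus; simpl. ring. }
  rewrite (RInt_plus (fun y => fst (P (m, y)) - fst (P (x1, y)))
    (fun y => fst (P (x2, y)) - fst (P (m, y)))) by (apply Hv; lra).
  unfold plus; simpl. ring.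
Qed.

Lemma circ_split_y P x1 x2 y1 m y2 : cdiff_box P x1 x2 y1 y2 -> y1 <= m <= y2 -> x1 <= x2 ->
  circ P x1 x2 y1 y2 = circ P x1 x2 y1 m + circ P x1 x2 m y2.
Proof.
  intros H Hm Hx. unfold circ.
  assert (Hv : forall a b, y1 <= a -> a <= b -> b <= y2 ->
    ex_RInt (fun y => fst (P (x2, y)) - fst (P (x1, y))) a b).
  { intros a b Ha Hab Hb.
    apply (ex_RInt_minus (fun y => fst (P (x2, y))) (fun y => fst (P (x1, y))));
      eapply ex_RInt_vertical; try eassumption; lra. }
  assert (Hh : forall c d, y1 <= c <= y2 -> y1 <= d <= y2 ->
    ex_RInt (fun x => snd (P (x, c)) - snd (P (x, d))) x1 x2).
  { intros c d Hc Hd.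
    apply (ex_RInt_minus (fun x => snd (P (x, c))) (fun x => snd (P (x, d))));
      eapply ex_RInt_horizontal; try eassumption; lra. }
  rewrite <- (RInt_Chasles (fun y => fst (P (x2, y)) - fst (P (x1, y))) y1 m y2) by (apply Hv; lra).
  rewrite (RInt_ext (fun x => snd (P (x, y1)) - snd (P (x, y2)))
    (fun x => plus (snd (P (x, y1)) - snd (P (x, m))) (snd (P (x, m)) - snd (P (x, y2))))).
  2: { intros x _. unfold plus; simpl. ring. }
  rewrite (RInt_plus (fun x => snd (P (x, y1)) - snd (P (x, m)))
    (fun x => snd (P (x, m)) - snd (P (x, y2)))) by (apply Hh; lra).
  unfold plus; simpl. ring.
Qed.

Lemma cdiff_box_sub P X1 X2 Y1 Y2 x1 x2 y1 y2 : cdiff_box P X1 X2 Y1 Y2 ->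
  X1 <= x1 -> x2 <= X2 -> Y1 <= y1 -> y2 <= Y2 -> cdiff_box P x1 x2 y1 y2.
Proof. intros H ? ? ? ? x y Hx Hy. apply H; lra. Qed.

(** The affine part of P contributes fst l * (y1 - y2) * (x2 - x1) from the horizontal edges and fst
    l * (x2 - x1) * (y2 - y1) from the vertical ones, and these cancel. What remains is an error of
    eps times the half perimeter [D] on each edge. *)
Lemma circ_local (P : C -> C) (px py : R) (l : C) (eps : R) :
  has_cderiv P (px, py) l -> 0 < eps ->
  exists d, 0 < d /\ forall x1 x2 y1 y2, cdiff_box P x1 x2 y1 y2 ->
    x1 <= px <= x2 -> y1 <= py <= y2 -> (x2 - x1) + (y2 - y1) < d ->
    Rabs (circ P x1 x2 y1 y2) <= 2 * eps * ((x2 - x1) + (y2 - y1)) ^ 2.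
Proof.
  intros H He. destruct (H eps He) as [d [d0 Hd]]. exists d. split; [exact d0|].
  intros x1 x2 y1 y2 HB Hx Hy Hs. set (D := (x2 - x1) + (y2 - y1)).
  assert (HE : forall x y, x1 <= x <= x2 -> y1 <= y <= y2 ->
    Cmod (P (x, y) - P (px, py) - l * (x - px, y - py)%R)%C <= eps * D).
  { intros x y Hx' Hy'.
    assert (Hm : Cmod (x - px, y - py) <= D).
    { eapply Rle_trans; [apply Cmod_le_abs_sum|]. unfold D. simpl.
      apply Rplus_le_compat; apply Rabs_le; lra. }
    specialize (Hd (x - px, y - py)).
    change (Cmod (x - px, y - py) < d -> Cmod (P ((px, py) + (x - px, y - py)%R) - P (px, py)
      - l * (x - px, y - py)%R)%C <= eps * Cmod (x - px, y - py)) in Hd.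
    replace ((px, py) + (x - px, y - py)%R)%C with (x, y) in Hd
      by (unfold Cplus; simpl; f_equal; ring).
    eapply Rle_trans; [apply Hd; unfold D in Hm; lra|]. apply Rmult_le_compat_l; lra. }
  assert (HF : forall x y, x1 <= x <= x2 -> y1 <= y <= y2 ->
    Rabs (fst (P (x, y)) - fst (P (px, py)) - (fst l * (x - px) - snd l * (y - py))) <= eps * D).
  { intros x y Hx' Hy'. exact (Rle_trans _ _ _ (fst_le_Cmod _) (HE x y Hx' Hy')). }
  assert (HS : forall x y, x1 <= x <= x2 -> y1 <= y <= y2 ->
    Rabs (snd (P (x, y)) - snd (P (px, py)) - (fst l * (y - py) + snd l * (x - px))) <= eps * D).
  { intros x y Hx' Hy'. exact (Rle_trans _ _ _ (snd_le_Cmod _) (HE x y Hx' Hy')). }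
  assert (I1 : Rabs (RInt (fun x => snd (P (x, y1)) - snd (P (x, y2))) x1 x2
     - fst l * (y1 - y2) * (x2 - x1)) <= (x2 - x1) * (2 * (eps * D))).
  { apply RInt_near_const; [lra| |].
    - apply (ex_RInt_minus (fun x => snd (P (x, y1))) (fun x => snd (P (x, y2))));
        eapply ex_RInt_horizontal; try eassumption; lra.
    - intros x Hx'. pose proof (HS x y1 Hx') as A1. pose proof (HS x y2 Hx') as A2.
      apply Rabs_le.
      destruct (proj1 (Rabs_le_between _ _) (A1 ltac:(lra))).
      destruct (proj1 (Rabs_le_between _ _) (A2 ltac:(lra))). lra. }
  assert (I2 : Rabs (RInt (fun y => fst (P (x2, y)) - fst (P (x1, y))) y1 y2
     - fst l * (x2 - x1) * (y2 - y1)) <= (y2 - y1) * (2 * (eps * D))).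
  { apply RInt_near_const; [lra| |].
    - apply (ex_RInt_minus (fun y => fst (P (x2, y))) (fun y => fst (P (x1, y))));
        eapply ex_RInt_vertical; try eassumption; lra.
    - intros y Hy'. assert (A1 := HF x2 y ltac:(lra) Hy'). assert (A2 := HF x1 y ltac:(lra) Hy').
      apply Rabs_le.
      destruct (proj1 (Rabs_le_between _ _) A1). destruct (proj1 (Rabs_le_between _ _) A2). lra. }
  unfold circ.
  apply Rabs_le. destruct (proj1 (Rabs_le_between _ _) I1). destruct (proj1 (Rabs_le_between _ _) I2).
  assert (E : (x2 - x1) * (2 * (eps * D)) + (y2 - y1) * (2 * (eps * D)) = 2 * eps * D ^ 2)
    by (unfold D; ring).
  lra.
Qed.

Lemma Goursat_rectangle (P : C -> C) (x1 x2 y1 y2 : R) : x1 < x2 -> y1 < y2 ->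
  cdiff_box P x1 x2 y1 y2 -> circ P x1 x2 y1 y2 = 0.
Proof.
  intros Hx Hy HB. apply NNPP. intros Hn.
  set (eta := Rabs (circ P x1 x2 y1 y2)).
  assert (eta0 : 0 < eta) by (apply Rabs_pos_lt; exact Hn).
  set (w := x2 - x1). set (h := y2 - y1).
  assert (w0 : 0 < w) by (unfold w; lra). assert (h0 : 0 < h) by (unfold h; lra).
  destruct (box_bisection (fun x y r => eta * r ^ 2 <= Rabs (circ P x (x + r * w) y (y + r * h)))
    w h x1 y1) as (px & py & Hpx & Hpy & Hp); try lra.
  - replace (x1 + 1 * w) with x2 by (unfold w; ring). replace (y1 + 1 * h) with y2 by (unfold h; ring).
    fold eta. lra.
  - intros x y r Hr A1 A2 A3 A4 HBad.
    assert (0 < r * w) by nra. assert (0 < r * h) by nra.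
    replace (r * w) with (r / 2 * w + r / 2 * w) in * by field.
    replace (r * h) with (r / 2 * h + r / 2 * h) in * by field.
    set (W := r / 2 * w) in *. set (H' := r / 2 * h) in *.
    assert (B0 : cdiff_box P x (x + (W + W)) y (y + (H' + H')))
      by (eapply cdiff_box_sub; [exact HB|unfold w, h in *; lra..]).
    rewrite (circ_split_x P x (x + W) (x + (W + W))) in HBad; [|exact B0|lra|lra].
    rewrite (circ_split_y P x (x + W) y (y + H')) in HBad;
      [|eapply cdiff_box_sub; [exact B0|lra..]|lra|lra].
    rewrite (circ_split_y P (x + W) (x + (W + W)) y (y + H')) in HBad;
      [|eapply cdiff_box_sub; [exact B0|lra..]|lra|lra].
    rewrite <- (Rplus_assoc x W W), <- (Rplus_assoc y H' H') in HBad.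
    (* The threshold scales like area, so if all four quarters stayed below [q], their sum would
       stay below 4 q. *)
    replace (eta * r ^ 2) with (4 * (eta * (r / 2) ^ 2)) in HBad by field.
    set (q := eta * (r / 2) ^ 2) in *.
    destruct (Rle_dec q (Rabs (circ P x (x + W) y (y + H')))) as [G1|G1].
    { exists x, y. auto. }
    destruct (Rle_dec q (Rabs (circ P x (x + W) (y + H') (y + H' + H')))) as [G2|G2].
    { exists x, (y + H'). auto. }
    destruct (Rle_dec q (Rabs (circ P (x + W) (x + W + W) y (y + H')))) as [G3|G3].
    { exists (x + W), y. auto. }
    exists (x + W), (y + H'). split; [auto|]. split; [auto|].
    pose proof (Rabs_triang (circ P x (x + W) y (y + H') + circ P x (x + W) (y + H') (y + H' + H'))
      (circ P (x + W) (x + W + W) y (y + H') + circ P (x + W) (x + W + W) (y + H') (y + H' + H'))).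
    pose proof (Rabs_triang (circ P x (x + W) y (y + H')) (circ P x (x + W) (y + H') (y + H' + H'))).
    pose proof (Rabs_triang (circ P (x + W) (x + W + W) y (y + H'))
      (circ P (x + W) (x + W + W) (y + H') (y + H' + H'))).
    lra.
  - destruct (HB px py) as [l Hl]; [unfold w in *; lra|unfold h in *; lra|].
    (* Chosen so that the bound of [circ_local] on a box of scale r is eta r^2 / 2, half of what
       badness demands. *)
    set (e := eta / (4 * (w + h) ^ 2)).
    assert (wh : 0 < (w + h) ^ 2) by (apply pow_lt; lra).
    assert (e0 : 0 < e) by (apply Rdiv_lt_0_compat; lra).
    destruct (circ_local P px py l e Hl e0) as (d & d0 & Hd).
    destruct (Hp (d / (w + h))) as (x & y & r & HBad & Hr & C1 & C2 & C3 & C4 & C5 & C6).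
    { apply Rdiv_lt_0_compat; lra. }
    specialize (Hd x (x + r * w) y (y + r * h)).
    replace (x + r * w - x + (y + r * h - y)) with (r * (w + h)) in Hd by ring.
    assert (T : Rabs (circ P x (x + r * w) y (y + r * h)) <= 2 * e * (r * (w + h)) ^ 2).
    { apply Hd; [|exact C1|exact C2|].
      - eapply cdiff_box_sub; [exact HB|unfold w, h in *; lra..].
      - replace d with (d / (w + h) * (w + h)) by (field; lra). apply Rmult_lt_compat_r; lra. }
    replace (2 * e * (r * (w + h)) ^ 2) with (eta * r ^ 2 / 2) in T by (unfold e; field; lra).
    assert (0 < eta * r ^ 2) by (apply Rmult_lt_0_compat; [exact eta0|apply pow_lt; lra]).
    lra.
Qed.

Lemma Cmod_sqr (s : C) : Cmod s ^ 2 = fst s ^ 2 + snd s ^ 2.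
Proof. apply Cmod2_alt. Qed.

(** Expanding the square leaves (F^2 - 2 F) / s. Since Re s >= -1 gives |s + 2| >= |s|, F is at most
    2 k / |s|, and |s| >= 1 absorbs the quadratic term. *)
Lemma Cauchy_square_estimate (g F s : C) (k : R) : 1 <= Cmod s -> -1 <= fst s ->
  Cmod g <= k -> F = (g * (2 * / (s + 2)))%C ->
  Cmod ((F - 1) * (F - 1) * / s - / s)%C <= (4 * k ^ 2 + 4 * k) / Cmod s ^ 2.
Proof.
  intros Hs Hre Hg EF.
  assert (Hs2 : Cmod s <= Cmod (s + 2)%C).
  { apply Rsqr_incr_0_var; [|apply Cmod_ge_0]. rewrite !Rsqr_pow2, !Cmod_sqr. simpl. nra. }
  assert (N2 : (s + 2)%C <> 0) by (apply Cmod_gt_0; lra).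
  assert (N1 : s <> 0) by (apply Cmod_gt_0; lra).
  pose proof (Cmod_ge_0 g) as g0.
  assert (HF : Cmod F <= 2 * k / Cmod s).
  { rewrite EF, !Cmod_mult, Cmod_R, Rabs_pos_eq, Cmod_inv by (exact N2 || lra).
    replace (2 * k / Cmod s) with (k * (2 * / Cmod s)) by (field; lra).
    assert (0 < / Cmod (s + 2)%C) by (apply Rinv_0_lt_compat; lra).
    apply Rmult_le_compat; [exact g0|lra|exact Hg|].
    apply Rmult_le_compat_l; [lra|]. apply Rinv_le_contravar; lra. }
  replace ((F - 1) * (F - 1) * / s - / s)%C with ((F * F - 2 * F) * / s)%C by ring.
  rewrite Cmod_mult, Cmod_inv by exact N1.
  assert (A : Cmod (F * F - 2 * F)%C <= (4 * k ^ 2 + 4 * k) / Cmod s).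
  { eapply Rle_trans; [apply Cmod_sub_le|]. rewrite !Cmod_mult, Cmod_R, Rabs_pos_eq by lra.
    pose proof (Cmod_ge_0 F) as F0.
    assert (k0 : 0 <= k) by lra.
    assert (I1 : / Cmod s <= 1) by (rewrite <- Rinv_1; apply Rinv_le_contravar; lra).
    assert (I0 : 0 < / Cmod s) by (apply Rinv_0_lt_compat; lra).
    unfold Rdiv in *. set (i := / Cmod s) in *.
    assert (Cmod F * Cmod F <= (2 * k * i) * (2 * k * i)) by (apply Rmult_le_compat; assumption).
    assert (4 * k ^ 2 * i * i <= 4 * k ^ 2 * i * 1)
      by (apply Rmult_le_compat_l; [|exact I1]; assert (0 <= k ^ 2) by nra; nra).
    nra. }
  replace ((4 * k ^ 2 + 4 * k) / Cmod s ^ 2) with ((4 * k ^ 2 + 4 * k) / Cmod s * / Cmod s)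
    by (field; lra).
  apply Rmult_le_compat_r; [left; apply Rinv_0_lt_compat; lra|exact A].
Qed.

(* With F = 2 G^n/(s+2), so that F(0) = 1, the function (F-1)^2/s differs from
   1/s by little on Re s = -1 and by O(1/|s|^2) far away; hence the imaginary part
   of its integral around a large rectangle is positive, against Goursat. *)
Lemma half_plane_max_normalized (G dG : C -> C) (B K : R) :
  (forall s, -1 <= fst s -> has_cderiv G s (dG s)) ->
  (forall s, -1 <= fst s -> Cmod (G s) <= B) ->
  (forall t, Cmod (G (-1, t)) <= K) -> K < 1 -> G 0%C = 1%C -> False.
Proof.
  intros HG HB HK K1 G0.
  assert (K0 : 0 <= K) by (eapply Rle_trans; [apply Cmod_ge_0|apply (HK 0)]).
  assert (B0 : 0 <= B) by (eapply Rle_trans; [apply Cmod_ge_0|apply (HB (RtoC 0)); simpl; lra]).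
  (* For k = 1/32 the constant 4 k^2 + 4 k is below 1, so on Re s = -1 the error cannot change the
     sign of Re (1/s) = -1/|s|^2. *)
  destruct (pow_lt_1_zero K) with (y := / 32) as [n Hn]; [rewrite Rabs_pos_eq; lra|lra|].
  specialize (Hn n (le_n _)). rewrite Rabs_pos_eq in Hn by (apply pow_le, K0).
  set (F := fun s : C => (G s ^ n * (2 * / (s + 2)))%C).
  set (P := fun s : C => ((F s - 1) * (F s - 1) * / s)%C).
  assert (N2 : forall s : C, -1 <= fst s -> (s + 2)%C <> 0).
  { intros s Hs E. pose proof (f_equal fst E) as T. simpl in T. lra. }
  assert (DF : forall s : C, -1 <= fst s -> exists l, has_cderiv (fun w => F w - 1)%C s l).
  { intros s Hs. destruct (has_cderiv_pow G s (dG s) n (HG s Hs)) as [l1 H1].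
    assert (H2 : has_cderiv (fun w : C => / (2 + 1 * w))%C s (1 * - / ((2 + 1 * s) * (2 + 1 * s)))%C).
    { apply (has_cderiv_comp_affine Cinv); [intros E; pose proof (f_equal fst E) as T; simpl in T; lra|].
      apply has_cderiv_inv. replace (2 + 1 * s)%C with (s + 2)%C by ring. apply N2, Hs. }
    eexists. apply (has_cderiv_ext (fun w => G w ^ n * (2 * / (2 + 1 * w)) - (1 + 0 * w))%C).
    { intros w. unfold F. replace (2 + 1 * w)%C with (w + 2)%C by ring. ring. }
    apply has_cderiv_sub; [|apply has_cderiv_affine].
    apply has_cderiv_mul; [exact H1|]. apply has_cderiv_scal, H2. }
  assert (F0 : F 0%C = 1%C).
  { unfold F. rewrite G0, Cpow_1_l. replace (0 + 2)%C with (RtoC 2) by ring.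
    rewrite Cinv_r; [ring|]. intros E. pose proof (f_equal fst E) as T. simpl in T. lra. }
  assert (DP : forall s : C, -1 <= fst s -> exists l, has_cderiv P s l).
  { intros s Hs. destruct (classic (s = 0%C)) as [->|Hn0].
    - destruct (DF 0%C Hs) as [l Hl]. eexists.
      apply (has_cderiv_sqr_div (fun w => F w - 1)%C); [rewrite F0; ring|exact Hl].
    - destruct (DF s Hs) as [l Hl]. eexists.
      apply has_cderiv_mul; [exact (has_cderiv_mul _ _ _ _ _ Hl Hl)|].
      apply has_cderiv_inv, Hn0. }
  assert (EP : forall (s : C) k, 1 <= Cmod s -> -1 <= fst s -> Cmod (G s ^ n)%C <= k ->
    Rabs (fst (P s) - fst s / Cmod s ^ 2) <= (4 * k ^ 2 + 4 * k) / Cmod s ^ 2 /\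
    Rabs (snd (P s) + snd s / Cmod s ^ 2) <= (4 * k ^ 2 + 4 * k) / Cmod s ^ 2).
  { intros s k Hs Hre Hk.
    pose proof (Cauchy_square_estimate (G s ^ n)%C (F s) s k Hs Hre Hk eq_refl) as T.
    fold (P s) in T. rewrite Cmod_sqr in *.
    split.
    - pose proof (Rle_trans _ _ _ (fst_le_Cmod _) T) as T1. exact T1.
    - pose proof (Rle_trans _ _ _ (snd_le_Cmod _) T) as T1.
      replace (snd (P s) + snd s / (fst s ^ 2 + snd s ^ 2)) with (snd (P s - / s)%C); [exact T1|].
      simpl. unfold Rdiv. ring. }
  set (c := 4 * (B ^ n) ^ 2 + 4 * B ^ n).
  assert (Bn : 0 <= B ^ n) by (apply pow_le, B0).
  assert (c0 : 0 <= c) by (unfold c; nra).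
  (* On the right, top and bottom edges the relevant coordinate of 1/s has size L / |s|^2, which
     exceeds the error c / |s|^2. *)
  set (L := c + 1).
  assert (HGB : forall s, -1 <= fst s -> Cmod (G s ^ n)%C <= B ^ n).
  { intros s Hs. rewrite Cmod_pow. apply pow_incr. split; [apply Cmod_ge_0|apply HB, Hs]. }
  assert (L1 : 1 <= L) by (unfold L; lra).
  assert (M1 : forall x y, 1 <= x ^ 2 + y ^ 2 -> 1 <= Cmod (x, y)).
  { intros x y H. apply Rsqr_incr_0_var; [|apply Cmod_ge_0]. rewrite !Rsqr_pow2, Cmod_sqr. simpl in *. lra. }
  assert (Hdiv : forall a b N, 0 < N -> a <= b -> a / N <= b / N).
  { intros a b N HN Hab. apply Rmult_le_compat_r; [left; apply Rinv_0_lt_compat, HN|exact Hab]. }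
  assert (Left : forall y, fst (P (-1, y)) < 0).
  { intros y. assert (Hs : 1 <= Cmod (-1, y)) by (apply M1; nra).
    destruct (EP (-1, y) (/ 32) Hs) as [T _]; [simpl; lra| |].
    { rewrite Cmod_pow. eapply Rle_trans; [apply pow_incr; split; [apply Cmod_ge_0|apply HK]|lra]. }
    set (N := Cmod (-1, y) ^ 2) in *. assert (HN : 0 < N) by (apply pow_lt; lra).
    change (fst (-1, y)) with (-1) in T.
    destruct (proj1 (Rabs_le_between _ _) T) as [_ T2].
    replace (-1 / N) with (- (1 / N)) in T2 by (field; lra).
    assert (0 < 1 / N) by (apply Rdiv_lt_0_compat; lra).
    replace ((4 * (/ 32) ^ 2 + 4 * / 32) / N) with ((4 * (/ 32) ^ 2 + 4 * / 32) * (1 / N)) in T2 by (field; lra).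
    nra. }
  assert (Right : forall y, 0 <= fst (P (L, y))).
  { intros y. assert (Hs : 1 <= Cmod (L, y)) by (apply M1; nra).
    destruct (EP (L, y) (B ^ n) Hs) as [T _]; [simpl; lra|apply HGB; simpl; lra|].
    fold c in T. set (N := Cmod (L, y) ^ 2) in *. assert (HN : 0 < N) by (apply pow_lt; lra).
    change (fst (L, y)) with L in T.
    destruct (proj1 (Rabs_le_between _ _) T) as [T1 _].
    assert (c / N <= L / N) by (apply Hdiv; unfold L; lra). lra. }
  assert (Top : forall x, -1 <= x -> snd (P (x, L)) <= 0).
  { intros x Hx. assert (Hs : 1 <= Cmod (x, L)) by (apply M1; nra).
    destruct (EP (x, L) (B ^ n) Hs) as [_ T]; [simpl; lra|apply HGB; simpl; lra|].
    fold c in T. set (N := Cmod (x, L) ^ 2) in *. assert (HN : 0 < N) by (apply pow_lt; lra).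
    change (snd (x, L)) with L in T.
    destruct (proj1 (Rabs_le_between _ _) T) as [_ T1].
    assert (c / N <= L / N) by (apply Hdiv; unfold L; lra). lra. }
  assert (Bot : forall x, -1 <= x -> 0 <= snd (P (x, - L))).
  { intros x Hx. assert (Hs : 1 <= Cmod (x, - L)) by (apply M1; nra).
    destruct (EP (x, - L) (B ^ n) Hs) as [_ T]; [simpl; lra|apply HGB; simpl; lra|].
    fold c in T. set (N := Cmod (x, - L) ^ 2) in *. assert (HN : 0 < N) by (apply pow_lt; lra).
    change (snd (x, - L)) with (- L) in T.
    destruct (proj1 (Rabs_le_between _ _) T) as [T1 _].
    replace (- L / N) with (- (L / N)) in T1 by (field; lra).
    assert (c / N <= L / N) by (apply Hdiv; unfold L; lra). lra. }
  assert (HBox : cdiff_box P (-1) L (- L) L) by (intros x y Hx Hy; apply DP; simpl; lra).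
  assert (Z : circ P (-1) L (- L) L = 0) by (apply Goursat_rectangle; [lra|lra|exact HBox]).
  unfold circ in Z.
  assert (I1 : 0 <= RInt (fun x => snd (P (x, - L)) - snd (P (x, L))) (-1) L).
  { apply RInt_ge_0; [lra| |].
    - apply (ex_RInt_minus (fun x => snd (P (x, - L))) (fun x => snd (P (x, L))));
        eapply ex_RInt_horizontal; try exact HBox; lra.
    - intros x Hx. pose proof (Top x). pose proof (Bot x). lra. }
  assert (I2 : 0 < RInt (fun y => fst (P (L, y)) - fst (P (-1, y))) (- L) L).
  { apply RInt_gt_0; [lra| |].
    - intros y Hy. pose proof (Left y). pose proof (Right y). lra.
    - intros y Hy. destruct (HBox L y) as [l1 Hl1]; [lra|lra|].
      destruct (HBox (-1) y) as [l2 Hl2]; [lra|lra|].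
      apply (continuous_minus (fun y => fst (P (L, y))) (fun y => fst (P (-1, y)))).
      + apply (has_cderiv_continuous_coord _ _ _ _ Hl1).
      + apply (has_cderiv_continuous_coord _ _ _ _ Hl2). }
  lra.
Qed.

(** The substitution z = (a, b) + (a - 1) s puts the point at s = 0 and the line Re z = 1 at Re s =
    -1. That line is interior to the half-plane, so the derivative exists on the closed edge of the
    contour. Dividing by f (a, b) normalises the value and makes the edge bound less than 1. *)
Lemma half_plane_max (f df : C -> C) (B K : R) : holo_on_Cplus f df ->
  (forall z, 0 < fst z -> Cmod (f z) <= B) -> (forall b, Cmod (f (1, b)) <= K) ->
  forall a b, 1 < a -> Cmod (f (a, b)) <= K.
Proof.
  intros H HB HK a b Ha. apply Rnot_lt_le. intros Hn.
  assert (K0 : 0 <= K) by (eapply Rle_trans; [apply Cmod_ge_0|apply (HK 0)]).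
  set (v := f (a, b)) in *. set (d := a - 1).
  assert (v0 : v <> 0) by (apply Cmod_gt_0; lra).
  assert (vi : 0 < / Cmod v) by (apply Rinv_0_lt_compat; lra).
  assert (d0 : 0 < d) by (unfold d; lra).
  assert (E : forall s : C, ((a, b) + RtoC d * s)%C = (a + d * fst s, b + d * snd s))
    by (intros [x y]; unfold Cplus, Cmult, RtoC; simpl; f_equal; ring).
  assert (P : forall s : C, -1 <= fst s -> 0 < fst ((a, b) + RtoC d * s)%C).
  { intros s Hs. rewrite E. simpl. unfold d in *. nra. }
  apply (half_plane_max_normalized (fun s => / v * f ((a, b) + RtoC d * s))%C
    (fun s => / v * (RtoC d * df ((a, b) + RtoC d * s)))%C (/ Cmod v * B) (/ Cmod v * K)).
  - intros s Hs. apply has_cderiv_scal. apply (has_cderiv_comp_affine f).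
    + intros T. apply (f_equal fst) in T. simpl in T. lra.
    + apply H, P, Hs.
  - intros s Hs. rewrite Cmod_mult, Cmod_inv by exact v0.
    apply Rmult_le_compat_l; [lra|]. apply HB, P, Hs.
  - intros t. rewrite Cmod_mult, Cmod_inv by exact v0.
    apply Rmult_le_compat_l; [lra|]. rewrite E. simpl.
    replace (a + d * -1) with 1 by (unfold d; ring). apply HK.
  - apply (Rmult_lt_reg_l (Cmod v)); [lra|]. rewrite <- Rmult_assoc, Rinv_r, Rmult_1_l, Rmult_1_r; lra.
  - rewrite Cmult_0_r, Cplus_0_r. fold v. apply Cinv_l, v0.
Qed.

(** * Exponentials and lacunary sums of exponentials *)

Definition cexp (w : C) : C := (exp (fst w) * cos (snd w), exp (fst w) * sin (snd w)).

Lemma exp_nondecreasing (x y : R) : x <= y -> exp x <= exp y.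
Proof. intros [H| ->]; [left; apply exp_increasing, H|right; reflexivity]. Qed.

Lemma cexp_add (z w : C) : cexp (z + w)%C = (cexp z * cexp w)%C.
Proof.
  unfold cexp, Cplus, Cmult; simpl. rewrite exp_plus, cos_plus, sin_plus. f_equal; ring.
Qed.

Lemma Cmod_cexp (w : C) : Cmod (cexp w) = exp (fst w).
Proof.
  unfold Cmod, cexp; simpl.
  replace (exp (fst w) * cos (snd w) * (exp (fst w) * cos (snd w) * 1) +
    exp (fst w) * sin (snd w) * (exp (fst w) * sin (snd w) * 1)) with (Rsqr (exp (fst w))).
  - apply sqrt_Rsqr. left; apply exp_pos.
  - pose proof (sin2_cos2 (snd w)) as T. unfold Rsqr in *.
    replace (exp (fst w) * exp (fst w)) with (exp (fst w) * exp (fst w) *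
      (sin (snd w) * sin (snd w) + cos (snd w) * cos (snd w))) by (rewrite T; ring). ring.
Qed.

Lemma MVT_from_0 (f df : R -> R) (y : R) : (forall x, is_derive f x (df x)) ->
  exists c, Rabs c <= Rabs y /\ f y - f 0 = df c * y.
Proof.
  intros H. destruct (MVT_gen f 0 y df) as (c & Hc & E).
  - intros x _. apply H.
  - intros x _. apply continuity_pt_filterlim, (ex_derive_continuous f). eexists. apply H.
  - exists c. split; [|rewrite E; ring].
    unfold Rmin, Rmax in Hc. destruct (Rle_dec 0 y).
    + rewrite !Rabs_pos_eq; lra.
    + rewrite !Rabs_left1; lra.
Qed.

Lemma abs_sin_le (y : R) : Rabs (sin y) <= Rabs y.
Proof.
  destruct (MVT_from_0 sin cos y) as (c & _ & E); [intros; apply is_derive_sin|].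
  rewrite sin_0, Rminus_0_r in E. rewrite E, Rabs_mult.
  assert (Rabs (cos c) <= 1) by (apply Rabs_le; apply COS_bound).
  pose proof (Rabs_pos y). nra.
Qed.

Lemma abs_cos_sub_1_le (y : R) : Rabs (cos y - 1) <= Rabs y ^ 2.
Proof.
  destruct (MVT_from_0 cos (fun x => - sin x) y) as (c & Hc & E); [intros; apply is_derive_cos|].
  rewrite cos_0 in E. rewrite E, Rabs_mult, Rabs_Ropp.
  pose proof (abs_sin_le c). pose proof (Rabs_pos y). nra.
Qed.

Lemma abs_sin_sub_le (y : R) : Rabs y <= 1 -> Rabs (sin y - y) <= Rabs y ^ 2.
Proof.
  intros Hy. destruct (MVT_from_0 (fun x => sin x - x) (fun x => cos x - 1) y) as (c & Hc & E).
  { intros x. auto_derive; [exact I|ring]. }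
  rewrite sin_0 in E. replace (sin y - y) with ((cos c - 1) * y) by lra. rewrite Rabs_mult.
  pose proof (abs_cos_sub_1_le c). pose proof (Rabs_pos y). pose proof (Rabs_pos c).
  assert (Rabs c ^ 2 <= Rabs y) by nra. nra.
Qed.

(** The inequality 1 + x <= exp x, used at x and at -x, encloses exp x between 1 + x and 1 / (1 -
    x). *)
Lemma exp_quadratic (x : R) : Rabs x <= / 2 -> Rabs (exp x - 1 - x) <= 2 * Rabs x ^ 2.
Proof.
  intros Hx. pose proof (exp_ineq1_le x) as T1. pose proof (exp_ineq1_le (- x)) as T2.
  rewrite exp_Ropp in T2. destruct (proj1 (Rabs_le_between _ _) Hx) as [L U].
  rewrite <- (Rsqr_pow2 (Rabs x)), <- Rsqr_abs, Rsqr_pow2.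
  rewrite Rabs_pos_eq by lra.
  pose proof (exp_pos x) as ep.
  apply (Rmult_le_compat_l (exp x)) in T2; [|lra]. rewrite Rinv_r in T2 by lra.
  nra.
Qed.

Lemma cexp_quadratic (w : C) : Cmod w <= / 2 ->
  Cmod (cexp w - 1 - w)%C <= 7 * Cmod w ^ 2.
Proof.
  intros Hw. destruct w as [x y].
  pose proof (fst_le_Cmod (x, y)) as Hx. pose proof (snd_le_Cmod (x, y)) as Hy. simpl in Hx, Hy.
  set (r := Cmod (x, y)) in *.
  eapply Rle_trans; [apply Cmod_le_abs_sum|]. simpl.
  pose proof (exp_quadratic x ltac:(lra)) as E. pose proof (abs_cos_sub_1_le y) as E2.
  pose proof (abs_sin_sub_le y ltac:(lra)) as E3. pose proof (abs_sin_le y) as E4.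
  pose proof (Rabs_pos x) as X0. pose proof (Rabs_pos y) as Y0.
  assert (X2 : Rabs x ^ 2 <= r ^ 2) by nra. assert (Y2 : Rabs y ^ 2 <= r ^ 2) by nra.
  assert (A1 : Rabs (exp x * cos y + - (1) + - x) <= 4 * r ^ 2).
  { replace (exp x * cos y + - (1) + - x) with ((exp x - 1 - x) * cos y + (1 + x) * (cos y - 1)) by ring.
    eapply Rle_trans; [apply Rabs_triang|]. rewrite !Rabs_mult.
    assert (Rabs (cos y) <= 1) by (apply Rabs_le; apply COS_bound).
    assert (Rabs (1 + x) <= 2).
    { eapply Rle_trans; [apply Rabs_triang|]. rewrite Rabs_R1. lra. }
    pose proof (Rabs_pos (exp x - 1 - x)). pose proof (Rabs_pos (cos y - 1)).
    pose proof (Rabs_pos (cos y)). nra. }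
  assert (A2 : Rabs (exp x * sin y + - 0 + - y) <= 3 * r ^ 2).
  { replace (exp x * sin y + - 0 + - y) with ((exp x - 1 - x) * sin y + x * sin y + (sin y - y)) by ring.
    eapply Rle_trans; [apply Rabs_triang|].
    eapply Rle_trans; [apply Rplus_le_compat_r, Rabs_triang|]. rewrite !Rabs_mult.
    pose proof (Rabs_pos (exp x - 1 - x)). pose proof (Rabs_pos (sin y)).
    assert (Rabs (exp x - 1 - x) <= Rabs x) by nra.
    assert (Rabs (exp x - 1 - x) * Rabs (sin y) <= r * r) by (apply Rmult_le_compat; lra).
    assert (Rabs x * Rabs (sin y) <= r * r) by (apply Rmult_le_compat; lra).
    nra. }
  nra.
Qed.

Definition expm (d : R) (z : C) : C := cexp (RtoC (- d) * z)%C.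

Lemma Cmod_expm d z : Cmod (expm d z) = exp (- (d * fst z)).
Proof. unfold expm. rewrite Cmod_cexp. f_equal. simpl. ring. Qed.

Lemma Cmod_expm_le_1 d z : 0 <= d -> 0 <= fst z -> Cmod (expm d z) <= 1.
Proof.
  intros Hd Hz. rewrite Cmod_expm, <- exp_0.
  apply exp_nondecreasing. nra.
Qed.

(** The constant does not depend on d or z, which is what allows lacunary sums to be differentiated
    term by term. *)
Lemma expm_quadratic d z h : 0 <= d <= 1 -> 0 <= fst z -> Cmod h <= / 2 ->
  Cmod (expm d (z + h) - expm d z - RtoC (- d) * expm d z * h)%C <= 7 * Cmod h ^ 2.
Proof.
  intros Hd Hz Hh.
  replace (expm d (z + h) - expm d z - RtoC (- d) * expm d z * h)%C
    with (expm d z * (cexp (RtoC (- d) * h) - 1 - RtoC (- d) * h))%C.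
  2: { unfold expm. replace (RtoC (- d) * (z + h))%C with (RtoC (- d) * z + RtoC (- d) * h)%C by ring.
       rewrite cexp_add. ring. }
  rewrite Cmod_mult. pose proof (Cmod_expm_le_1 d z ltac:(lra) Hz) as E.
  pose proof (Cmod_ge_0 (expm d z)) as E0. pose proof (Cmod_ge_0 h) as h0.
  assert (Em : Cmod (RtoC (- d) * h)%C = d * Cmod h)
    by (rewrite Cmod_mult, Cmod_R, Rabs_Ropp, Rabs_pos_eq; lra).
  pose proof (cexp_quadratic (RtoC (- d) * h)%C) as Q. rewrite Em in Q.
  assert (Hdh : d * Cmod h <= Cmod h) by nra. specialize (Q ltac:(lra)).
  pose proof (Cmod_ge_0 (cexp (RtoC (- d) * h) - 1 - RtoC (- d) * h)%C).
  assert ((d * Cmod h) ^ 2 <= Cmod h ^ 2) by (apply pow_incr; nra).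
  nra.
Qed.

Lemma fst_expm_real d a : fst (expm d (RtoC a)) = exp (- (d * a)).
Proof.
  unfold expm, cexp; simpl. replace (- d * 0 + 0 * a) with 0 by ring. rewrite cos_0.
  rewrite Rmult_1_r. f_equal. ring.
Qed.

Lemma holo_expm d : 0 <= d <= 1 ->
  holo_on_Cplus (expm d) (fun z => RtoC (- d) * expm d z)%C.
Proof.
  intros Hd z Hz. apply (has_cderiv_quadratic _ _ _ 7 (/ 2)); [lra|].
  intros h Hh. apply expm_quadratic; [exact Hd|left; exact Hz|lra].
Qed.

Lemma exp_neg_eventually_lt (d eps : R) : 0 < d -> 0 < eps ->
  exists A, 0 < A /\ forall a, A <= a -> exp (- (d * a)) <= eps.
Proof.
  intros Hd He. exists (Rmax 1 (- ln eps / d)). split.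
  { eapply Rlt_le_trans; [apply Rlt_0_1|apply Rmax_l]. }
  intros a Ha. pose proof (Rle_trans _ _ _ (Rmax_r _ _) Ha) as H.
  apply (Rmult_le_compat_l d) in H; [|lra].
  replace (d * (- ln eps / d)) with (- ln eps) in H by (field; lra).
  rewrite <- (exp_ln eps) by exact He.
  apply exp_nondecreasing. lra.
Qed.

Lemma inB0_expm d : 0 < d <= 1 -> inB0 (expm d).
Proof.
  intros Hd. split.
  - exists (fun z => RtoC (- d) * expm d z)%C. split; [apply holo_expm; lra|]. split.
    + exists 1. intros z Hz. apply Cmod_expm_le_1; [lra|left; exact Hz].
    + exists 1. apply (B0int_le_of_antiderivative _ (fun a => exp (- (d * a)))
        (fun a => d * exp (- (d * a)))).
      * intros a _. auto_derive; [exact I|ring].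
      * intros a b _. rewrite Cmod_mult, Cmod_R, Rabs_Ropp, Rabs_pos_eq, Cmod_expm by lra.
        simpl. lra.
      * intros a Ha. split; [left; apply exp_pos|].
        pose proof (Cmod_expm_le_1 d (RtoC a) ltac:(lra)) as T. rewrite Cmod_expm in T.
        apply T. simpl. lra.
  - intros eps He. destruct (exp_neg_eventually_lt d (eps / 2)) as (A & _ & HA); [lra|lra|].
    exists A. intros z Hz. change (Cmod (expm d z) < eps). rewrite Cmod_expm.
    apply Rle_lt_trans with (eps / 2); [|lra]. apply HA. left. exact Hz.
Qed.

(** * Absolutely convergent complex series and lacunary sums *)

Definition Csum (u : nat -> C) : C := (Series (fun n => fst (u n)), Series (fun n => snd (u n))).

Definition Csummable (u : nat -> C) : Prop := ex_series (fun n => Cmod (u n)).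

Lemma Csummable_le (u : nat -> C) (b : nat -> R) :
  (forall n, Cmod (u n) <= b n) -> ex_series b -> Csummable u.
Proof.
  intros H Hb. apply (ex_series_le (fun n => Cmod (u n)) b); [|exact Hb].
  intros n. unfold norm; simpl. unfold abs; simpl. rewrite Rabs_pos_eq by apply Cmod_ge_0. apply H.
Qed.

Lemma Csummable_abs (u : nat -> C) : Csummable u ->
  ex_series (fun n => Rabs (fst (u n))) /\ ex_series (fun n => Rabs (snd (u n))).
Proof.
  intros H. split.
  - apply (ex_series_le (fun n => Rabs (fst (u n))) (fun n => Cmod (u n))); [|exact H].
    intros n. unfold norm; simpl. unfold abs; simpl. rewrite Rabs_Rabsolu. apply fst_le_Cmod.
  - apply (ex_series_le (fun n => Rabs (snd (u n))) (fun n => Cmod (u n))); [|exact H].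
    intros n. unfold norm; simpl. unfold abs; simpl. rewrite Rabs_Rabsolu. apply snd_le_Cmod.
Qed.

Lemma Csummable_coord (u : nat -> C) : Csummable u ->
  ex_series (fun n => fst (u n)) /\ ex_series (fun n => snd (u n)).
Proof. intros H. split; apply ex_series_Rabs, Csummable_abs, H. Qed.

(** The factor 2 comes from estimating real and imaginary parts separately, each by the full
    majorant. *)
Lemma Cmod_Csum_le (u : nat -> C) (b : nat -> R) :
  (forall n, Cmod (u n) <= b n) -> ex_series b -> Cmod (Csum u) <= 2 * Series b.
Proof.
  intros H Hb. pose proof (Csummable_abs _ (Csummable_le u b H Hb)) as [E1 E2].
  eapply Rle_trans; [apply Cmod_le_abs_sum|]. simpl.
  pose proof (Series_Rabs _ E1) as S1. pose proof (Series_Rabs _ E2) as S2.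
  assert (T1 : Series (fun n => Rabs (fst (u n))) <= Series b).
  { apply Series_le; [|exact Hb]. intros n. split; [apply Rabs_pos|].
    eapply Rle_trans; [apply fst_le_Cmod|apply H]. }
  assert (T2 : Series (fun n => Rabs (snd (u n))) <= Series b).
  { apply Series_le; [|exact Hb]. intros n. split; [apply Rabs_pos|].
    eapply Rle_trans; [apply snd_le_Cmod|apply H]. }
  lra.
Qed.

Lemma Csum_sub (u v : nat -> C) : Csummable u -> Csummable v ->
  Csum (fun n => u n - v n)%C = (Csum u - Csum v)%C.
Proof.
  intros Hu Hv. destruct (Csummable_coord _ Hu) as [U1 U2]. destruct (Csummable_coord _ Hv) as [V1 V2].
  unfold Csum, Cminus, Cplus, Copp; simpl. f_equal; apply Series_minus; assumption.
Qed.

Lemma Csum_mulr (u : nat -> C) (h : C) : Csummable u ->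
  Csum (fun n => u n * h)%C = (Csum u * h)%C.
Proof.
  intros Hu. destruct (Csummable_coord _ Hu) as [U1 U2].
  assert (S : forall a c, ex_series a -> ex_series (fun n : nat => a n * c))
    by (intros a c Ha; apply ex_series_scal_r, Ha).
  unfold Csum, Cmult; simpl. f_equal.
  - rewrite (Series_minus (fun n => fst (u n) * fst h) (fun n => snd (u n) * snd h)) by (apply S; assumption).
    rewrite !Series_scal_r. reflexivity.
  - rewrite (Series_plus (fun n => fst (u n) * snd h) (fun n => snd (u n) * fst h)) by (apply S; assumption).
    rewrite !Series_scal_r. reflexivity.
Qed.

Lemma Csummable_mulr (u : nat -> C) (h : C) : Csummable u -> Csummable (fun n => u n * h)%C.
Proof.
  intros H. apply (ex_series_ext (fun n => Cmod (u n) * Cmod h)).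
  - intros n. symmetry. apply Cmod_mult.
  - apply ex_series_scal_r, H.
Qed.

Lemma Csummable_sub (u v : nat -> C) :
  Csummable u -> Csummable v -> Csummable (fun n => u n - v n)%C.
Proof.
  intros Hu Hv. apply (Csummable_le _ (fun n => Cmod (u n) + Cmod (v n))).
  - intros n. apply Cmod_sub_le.
  - exact (ex_series_plus _ _ Hu Hv).
Qed.

Lemma Series_single (a : nat -> R) (n : nat) :
  (forall k, k <> n -> a k = 0) -> Series a = a n.
Proof.
  intros H. rewrite (Series_incr_n_aux a n) by (intros k Hk; apply H; lia).
  (* Writing the zero tail as a multiple of a geometric series provides both its convergence and its
     sum. *)
  assert (Z : forall k, a (n + S k)%nat = 0 * (/ 2) ^ k) by (intros k; rewrite H by lia; ring).
  rewrite Series_incr_1.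
  - rewrite (Series_ext _ _ Z), Series_scal_l, Nat.add_0_r. ring.
  - apply ex_series_incr_1. apply (ex_series_ext (fun k => scal 0 ((/ 2) ^ k))).
    + intros k. symmetry. exact (Z k).
    + apply (ex_series_scal 0 (fun k => (/ 2) ^ k)), ex_series_geom. rewrite Rabs_pos_eq; lra.
Qed.

Definition lac_term (dl : nat -> R) (z : C) (n : nat) : C := (RtoC ((/ 100) ^ n) * expm (dl n) z)%C.
Definition lac (dl : nat -> R) (z : C) : C := Csum (lac_term dl z).
Definition dlac (dl : nat -> R) (z : C) : C :=
  Csum (fun n => RtoC (- dl n) * lac_term dl z n)%C.

Lemma ex_series_geom100 : ex_series (fun n => (/ 100) ^ n).
Proof. apply ex_series_geom. rewrite Rabs_pos_eq; lra. Qed.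

Lemma Series_geom100 : Series (fun n => (/ 100) ^ n) = 100 / 99.
Proof. rewrite Series_geom by (rewrite Rabs_pos_eq; lra). field. Qed.

Lemma pow100_pos n : 0 < (/ 100) ^ n.
Proof. apply pow_lt. lra. Qed.

Lemma Cmod_lac_term dl z n : Cmod (lac_term dl z n) = (/ 100) ^ n * exp (- (dl n * fst z)).
Proof.
  unfold lac_term. rewrite Cmod_mult, Cmod_R, Rabs_pos_eq by (left; apply pow100_pos).
  rewrite Cmod_expm. reflexivity.
Qed.

Lemma fst_RtoC_mul (r : R) (z : C) : fst (RtoC r * z)%C = r * fst z.
Proof. simpl. ring. Qed.

Lemma fst_lac_term_real dl a n :
  fst (lac_term dl (RtoC a) n) = (/ 100) ^ n * exp (- (dl n * a)).
Proof. unfold lac_term. rewrite fst_RtoC_mul, fst_expm_real. reflexivity. Qed.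

Definition unit_rates (dl : nat -> R) : Prop := forall n, 0 < dl n <= 1.

Lemma Cmod_lac_term_le dl z n : unit_rates dl -> 0 <= fst z -> Cmod (lac_term dl z n) <= (/ 100) ^ n.
Proof.
  intros Hdl Hz. rewrite Cmod_lac_term, <- Cmod_expm. pose proof (pow100_pos n).
  pose proof (Hdl n). pose proof (Cmod_expm_le_1 (dl n) z ltac:(lra) Hz). nra.
Qed.

Lemma Csummable_lac dl z : unit_rates dl -> 0 <= fst z -> Csummable (lac_term dl z).
Proof.
  intros Hdl Hz. apply (Csummable_le _ _ (fun n => Cmod_lac_term_le dl z n Hdl Hz)), ex_series_geom100.
Qed.

Lemma Cmod_dlac_term dl z n : unit_rates dl ->
  Cmod (RtoC (- dl n) * lac_term dl z n)%C = dl n * Cmod (lac_term dl z n).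
Proof.
  intros Hdl. rewrite Cmod_mult, Cmod_R, Rabs_Ropp, Rabs_pos_eq by (pose proof (Hdl n); lra). reflexivity.
Qed.

Lemma Cmod_dlac_term_le dl z n : unit_rates dl -> 0 <= fst z ->
  Cmod (RtoC (- dl n) * lac_term dl z n)%C <= (/ 100) ^ n.
Proof.
  intros Hdl Hz. rewrite Cmod_dlac_term by exact Hdl. pose proof (Cmod_lac_term_le dl z n Hdl Hz).
  pose proof (Hdl n). pose proof (Cmod_ge_0 (lac_term dl z n)). nra.
Qed.

Lemma Csummable_dlac dl z : unit_rates dl -> 0 <= fst z ->
  Csummable (fun n => RtoC (- dl n) * lac_term dl z n)%C.
Proof.
  intros Hdl Hz. apply (Csummable_le _ _ (fun n => Cmod_dlac_term_le dl z n Hdl Hz)), ex_series_geom100.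
Qed.

Lemma holo_lac dl : unit_rates dl -> holo_on_Cplus (lac dl) (dlac dl).
Proof.
  intros Hdl z Hz. change (0 < fst z) in Hz.
  (* 7 is the constant of [expm_quadratic], 100/99 the sum of the coefficients, 2 the factor of
     [Cmod_Csum_le]. The radius keeps z + h in the half-plane. *)
  apply (has_cderiv_quadratic _ _ _ (2 * (100 / 99 * 7)) (Rmin (/ 2) (fst z)));
    [apply Rmin_pos; lra|].
  intros h Hh. apply Rmin_Rgt_l in Hh. destruct Hh as [H1 H2].
  assert (Hzh : 0 <= fst (z + h)%C).
  { simpl. pose proof (fst_le_Cmod h) as T. destruct (proj1 (Rabs_le_between _ _) T). lra. }
  assert (Z0 : 0 <= fst z) by lra.
  unfold lac, dlac.
  assert (S1 := Csummable_lac dl (z + h)%C Hdl Hzh). assert (S2 := Csummable_lac dl z Hdl Z0).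
  assert (S3 := Csummable_dlac dl z Hdl Z0).
  rewrite <- (Csum_mulr _ h S3), <- (Csum_sub _ _ S1 S2).
  rewrite <- (Csum_sub _ _ (Csummable_sub _ _ S1 S2) (Csummable_mulr _ h S3)).
  rewrite <- Series_geom100, <- Series_scal_r, Rmult_assoc, <- Series_scal_r.
  apply Cmod_Csum_le.
  - intros n. unfold lac_term.
    replace (RtoC ((/ 100) ^ n) * expm (dl n) (z + h) - RtoC ((/ 100) ^ n) * expm (dl n) z -
      RtoC (- dl n) * (RtoC ((/ 100) ^ n) * expm (dl n) z) * h)%C with
      (RtoC ((/ 100) ^ n) * (expm (dl n) (z + h) - expm (dl n) z - RtoC (- dl n) * expm (dl n) z * h))%C
      by ring.
    rewrite Cmod_mult, Cmod_R, Rabs_pos_eq by (left; apply pow100_pos).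
    rewrite Rmult_assoc. apply Rmult_le_compat_l; [left; apply pow100_pos|].
    apply expm_quadratic; [pose proof (Hdl n); lra|exact Z0|lra].
  - apply ex_series_scal_r, ex_series_scal_r, ex_series_geom100.
Qed.

(** The moduli of the terms do not depend on the ordinate, and on the real axis all terms of the
    derivative are real and of one sign. Hence the majorant of the vertical supremum is itself the
    derivative of -2 [lac] on the axis. *)
Lemma inB_lac dl : unit_rates dl -> inB (lac dl).
Proof.
  intros Hdl. exists (dlac dl). split; [exact (holo_lac dl Hdl)|].
  assert (HB : forall z, 0 < fst z -> Cmod (lac dl z) <= 2 * (100 / 99)).
  { intros z Hz. rewrite <- Series_geom100. apply Cmod_Csum_le; [|exact ex_series_geom100].
    intros n. apply Cmod_lac_term_le; [exact Hdl|lra]. }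
  split; [exists (2 * (100 / 99)); exact HB|].
  exists (2 * (2 * (100 / 99))).
  apply (B0int_le_of_antiderivative _ (fun a => 2 * fst (lac dl (RtoC a)))
    (fun a => - (2 * fst (dlac dl (RtoC a))))).
  - intros a Ha. rewrite Ropp_involutive. apply (is_derive_scal (fun a => fst (lac dl (RtoC a)))).
    apply is_derive_fst_real, holo_lac; [exact Hdl|exact Ha].
  - intros a b Ha.
    replace (- (2 * fst (dlac dl (RtoC a)))) with
      (2 * Series (fun n => dl n * Cmod (lac_term dl (a, b) n))).
    + apply Cmod_Csum_le.
      * intros n. rewrite Cmod_dlac_term by exact Hdl. lra.
      * apply (ex_series_ext _ _ (fun n => Cmod_dlac_term dl (a, b) n Hdl)).
        apply (Csummable_dlac dl (a, b)); [exact Hdl|simpl; lra].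
    + unfold dlac, Csum. change (fst (?x, ?y)) with x. cbv beta.
      rewrite <- Ropp_mult_distr_r_reverse, <- Series_opp. f_equal. apply Series_ext. intros n.
      rewrite Cmod_lac_term, fst_RtoC_mul, fst_lac_term_real. change (fst (a, b)) with a. ring.
  - intros a Ha. split.
    + apply Rmult_le_pos; [lra|]. unfold lac, Csum. change (fst (?x, ?y)) with x.
      apply Rle_trans with (Series (fun n : nat => 0 * (/ 100) ^ n)); [rewrite Series_scal_l; lra|].
      apply Series_le; [|apply Csummable_coord, Csummable_lac; [exact Hdl|simpl; lra]].
      intros n. rewrite Rmult_0_l, fst_lac_term_real. split; [lra|].
      apply Rmult_le_pos; left; [apply pow100_pos|apply exp_pos].
    + apply Rmult_le_compat_l; [lra|]. eapply Rle_trans; [apply Rle_abs|].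
      eapply Rle_trans; [apply fst_le_Cmod|]. apply HB. exact Ha.
Qed.

(** Earlier terms have decayed by Re z >= s, later ones have small coefficients. Each group sums to
    at most 100^-n / 99, and doubling for [Cmod_Csum_le] gives 4/99 < 1/20. *)
Lemma lac_dominant_term dl (s : R) (n : nat) (z : C) : unit_rates dl -> 0 <= s ->
  (forall k, (k < n)%nat -> exp (- (dl k * s)) <= (/ 100) ^ n / 100) -> s <= fst z ->
  Cmod (lac dl z - lac_term dl z n)%C <= (/ 100) ^ n / 20.
Proof.
  intros Hdl Hs Hk Hz. assert (Z0 : 0 <= fst z) by lra.
  set (u := fun k => if Nat.eq_dec k n then lac_term dl z n else RtoC 0).
  assert (Eu : Csum u = lac_term dl z n).
  { unfold Csum. rewrite !(Series_single _ n).
    - unfold u. destruct (Nat.eq_dec n n); [|lia]. symmetry. apply surjective_pairing.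
    - intros k Hkn. unfold u. destruct (Nat.eq_dec k n); [lia|reflexivity].
    - intros k Hkn. unfold u. destruct (Nat.eq_dec k n); [lia|reflexivity]. }
  assert (Su : Csummable u).
  { apply (Csummable_le _ (fun k => (/ 100) ^ k)); [|apply ex_series_geom100].
    intros k. unfold u. destruct (Nat.eq_dec k n) as [->|_]; [apply Cmod_lac_term_le; assumption|].
    rewrite Cmod_0. left; apply pow100_pos. }
  rewrite <- Eu. unfold lac. rewrite <- Csum_sub; [|apply Csummable_lac; assumption|exact Su].
  set (t := fun k => if le_lt_dec k n then 0 else (/ 100) ^ k).
  assert (Et : Series t = (/ 100) ^ n / 100 * (100 / 99)).
  { rewrite (Series_incr_n_aux t (S n)).
    - rewrite (Series_ext _ (fun k => (/ 100) ^ n / 100 * (/ 100) ^ k)).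
      + rewrite (Series_scal_l _ (fun k => (/ 100) ^ k)), Series_geom100. reflexivity.
      + intros k. unfold t. destruct (le_lt_dec (S n + k) n); [lia|].
        rewrite pow_add. simpl. unfold Rdiv. ring.
    - intros k Hkn. unfold t. destruct (le_lt_dec k n); [reflexivity|lia]. }
  assert (St : ex_series t).
  { apply (ex_series_le t (fun k => (/ 100) ^ k)); [|apply ex_series_geom100].
    intros k. unfold norm; simpl. unfold abs; simpl. unfold t. pose proof (pow100_pos k).
    destruct (le_lt_dec k n); [rewrite Rabs_R0; lra|rewrite Rabs_pos_eq; lra]. }
  pose proof (pow100_pos n) as pn.
  apply Rle_trans with (2 * Series (fun k => (/ 100) ^ n / 100 * (/ 100) ^ k + t k)).
  - apply Cmod_Csum_le.
    + intros k. unfold u, t. pose proof (pow100_pos k) as pk.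
      destruct (Nat.eq_dec k n) as [->|Hkn].
      * replace (lac_term dl z n - lac_term dl z n)%C with (RtoC 0) by ring. rewrite Cmod_0.
        destruct (le_lt_dec n n); [|lia]. nra.
      * replace (lac_term dl z k - 0)%C with (lac_term dl z k) by ring.
        destruct (le_lt_dec k n).
        -- rewrite Cmod_lac_term, Rplus_0_r, Rmult_comm. apply Rmult_le_compat_r; [lra|].
           eapply Rle_trans; [|apply (Hk k); lia].
           apply exp_nondecreasing. pose proof (Hdl k). nra.
        -- pose proof (Cmod_lac_term_le dl z k Hdl Z0). nra.
    + apply (ex_series_plus (fun k => (/ 100) ^ n / 100 * (/ 100) ^ k) t); [|exact St].
      apply (ex_series_scal ((/ 100) ^ n / 100) (fun k => (/ 100) ^ k)), ex_series_geom100.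
  - rewrite (Series_plus (fun k => (/ 100) ^ n / 100 * (/ 100) ^ k) t);
      [|apply (ex_series_scal ((/ 100) ^ n / 100) (fun k => (/ 100) ^ k)), ex_series_geom100|exact St].
    rewrite (Series_scal_l _ (fun k => (/ 100) ^ k)), Series_geom100, Et. nra.
Qed.

(** * Multipliers *)

Lemma inB0_mul (m f : C -> C) : inB m -> inB0 f -> inB0 (fun z => m z * f z)%C.
Proof.
  intros (dm & Hm & (Km & Bm) & (Im & IIm)) ((df & Hf & (Kf & Bf) & (If & IIf)) & Df).
  assert (Km0 : 0 <= Km) by (eapply Rle_trans; [apply Cmod_ge_0|apply (Bm (1, 0)); exact Rlt_0_1]).
  assert (Kf0 : 0 <= Kf) by (eapply Rle_trans; [apply Cmod_ge_0|apply (Bf (1, 0)); exact Rlt_0_1]).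
  split.
  - exists (fun z => dm z * f z + m z * df z)%C. split; [|split].
    + intros z Hz. exact (has_cderiv_mul _ _ _ _ _ (Hm z Hz) (Hf z Hz)).
    + exists (Km * Kf). intros z Hz. change (Cmod (m z * f z)%C <= Km * Kf). rewrite Cmod_mult.
      apply Rmult_le_compat; try apply Cmod_ge_0; [exact (Bm z Hz)|exact (Bf z Hz)].
    + exists (Kf * Im + Km * If). apply (B0int_le_combine m f dm df); try assumption.
      intros a b Ha. eapply Rle_trans; [apply Cmod_triangle|]. rewrite !Cmod_mult.
      pose proof (Bm (a, b) Ha) as T1. pose proof (Bf (a, b) Ha) as T2.
      change (Cmod (m (a, b)) <= Km) in T1. change (Cmod (f (a, b)) <= Kf) in T2.
      pose proof (Cmod_ge_0 (dm (a, b))). pose proof (Cmod_ge_0 (df (a, b))). nra.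
  - intros eps He. destruct (Df (eps / (Km + 1))) as [A HA]; [apply Rdiv_lt_0_compat; lra|].
    (* The threshold [A] may be negative, whereas m is bounded only for Re z > 0. *)
    exists (Rmax A 0). intros z Hz. change (Rmax A 0 < fst z) in Hz.
    pose proof (Rmax_l A 0). pose proof (Rmax_r A 0).
    assert (z1 : A < Defs.Re z) by (unfold Defs.Re; lra).
    assert (z0 : 0 < Defs.Re z) by (unfold Defs.Re; lra).
    change (Cmod (m z * f z)%C < eps). rewrite Cmod_mult.
    specialize (HA z z1). specialize (Bm z z0).
    change (Cmod (m z) <= Km) in Bm. change (Cmod (f z) < eps / (Km + 1)) in HA.
    pose proof (Cmod_ge_0 (m z)). pose proof (Cmod_ge_0 (f z)).
    apply Rle_lt_trans with (Km * Cmod (f z)); [apply Rmult_le_compat_r; assumption|].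
    apply Rle_lt_trans with (Km * (eps / (Km + 1))); [apply Rmult_le_compat_l; lra|].
    replace eps with ((Km + 1) * (eps / (Km + 1))) at 2 by (field; lra).
    apply Rmult_lt_compat_r; [apply Rdiv_lt_0_compat|]; lra.
Qed.

(** Up to Re z = 1, the bound of m exp(-z) suffices because exp(-z) is bounded below there. *)
Lemma multiplier_bounded (m dm : C -> C) : holo_on_Cplus m dm ->
  (forall f, inB0 f -> inB0 (fun z => m z * f z)%C) ->
  exists K, forall z, 0 < fst z -> Cmod (m z) <= K.
Proof.
  intros Hm Hmul.
  destruct (Hmul _ (inB0_expm 1 ltac:(lra))) as ((_ & _ & (K1 & B1) & _) & _).
  exists (exp 1 * K1).
  assert (Near : forall a b, 0 < a <= 1 -> Cmod (m (a, b)) <= exp 1 * K1).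
  { intros a b Ha. pose proof (B1 (a, b) (proj1 Ha)) as T.
    change (Cmod (m (a, b) * expm 1 (a, b))%C <= K1) in T. rewrite Cmod_mult, Cmod_expm in T.
    simpl in T. apply (Rmult_le_compat_l (exp 1)) in T; [|left; apply exp_pos].
    eapply Rle_trans; [|exact T].
    replace (exp 1 * (Cmod (m (a, b)) * exp (- (1 * a)))) with (Cmod (m (a, b)) * exp (1 + - (1 * a)))
      by (rewrite exp_plus; ring).
    rewrite <- (Rmult_1_r (Cmod (m (a, b)))) at 1. apply Rmult_le_compat_l; [apply Cmod_ge_0|].
    apply Rle_trans with (exp 0); [rewrite exp_0; lra|]. apply exp_nondecreasing. lra. }
  intros [a b] Ha. simpl in Ha.
  destruct (Rle_dec a 1) as [Ha1|Ha1]; [apply Near; lra|].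
  (* The a priori bound [K2] depends on d, but the maximum principle replaces it by the bound on Re
     z = 1, which does not. *)
  assert (Far : forall d, 0 < d <= 1 -> Cmod (m (a, b)) * exp (- (d * a)) <= exp 1 * K1).
  { intros d Hd.
    destruct (Hmul _ (inB0_expm d Hd)) as ((_ & _ & (K2 & B2) & _) & _).
    replace (Cmod (m (a, b)) * exp (- (d * a))) with (Cmod (m (a, b) * expm d (a, b))%C)
      by (rewrite Cmod_mult, Cmod_expm; reflexivity).
    apply (half_plane_max (fun z => m z * expm d z)%C
      (fun z => dm z * expm d z + m z * (RtoC (- d) * expm d z))%C K2).
    - intros z Hz. apply has_cderiv_mul; [exact (Hm z Hz)|]. apply holo_expm; [lra|exact Hz].
    - exact B2.
    - intros y. rewrite Cmod_mult. pose proof (Near 1 y ltac:(lra)).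
      pose proof (Cmod_expm_le_1 d (1, y) ltac:(lra) ltac:(simpl; lra)).
      pose proof (Cmod_ge_0 (m (1, y))). nra.
    - lra. }
  apply Rnot_lt_le. intros Hlt. set (M := Cmod (m (a, b))) in *. set (K := exp 1 * K1) in *.
  assert (K0 : 0 <= K) by (eapply Rle_trans; [apply Cmod_ge_0|apply (Near 1 0); lra]).
  (* exp (-d a) >= 1 - d a, and d a = (M - K) / (2 M) leaves M exp (-d a) > K *)
  set (d := (M - K) / (2 * M * a)).
  assert (Md : d * a = (M - K) / (2 * M)) by (unfold d; field; lra).
  assert (d0 : 0 < d) by (apply Rdiv_lt_0_compat; [lra|nra]).
  assert (d1 : d * a <= 1).
  { rewrite Md. apply (Rmult_le_reg_r (2 * M)); [lra|].
    replace ((M - K) / (2 * M) * (2 * M)) with (M - K) by (field; lra). lra. }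
  assert (Hd : 0 < d <= 1) by (split; [exact d0|nra]).
  specialize (Far d Hd). pose proof (exp_ineq1_le (- (d * a))) as E. rewrite Md in *.
  assert (M * (1 + - ((M - K) / (2 * M))) = (M + K) / 2) by (field; lra).
  nra.
Qed.

(** By the product rule m' f = (m f)' - m f'. Membership of m f supplies some derivative of it,
    which uniqueness identifies with the product rule. *)
Lemma multiplier_deriv_B0int (m dm f : C -> C) (K : R) : holo_on_Cplus m dm ->
  (forall z, 0 < fst z -> Cmod (m z) <= K) -> inB0 f -> inB0 (fun z => m z * f z)%C ->
  exists K', B0int_le (fun z => dm z * f z)%C K'.
Proof.
  intros Hm HK ((df & Hf & _ & (If & IIf)) & _) ((dmf & Hmf & _ & (Im & IIm)) & _).
  assert (K0 : 0 <= K) by (eapply Rle_trans; [apply Cmod_ge_0|apply (HK (1, 0)); exact Rlt_0_1]).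
  exists (1 * Im + K * If).
  apply (B0int_le_combine (fun z => m z * f z)%C f dmf df); try assumption; [lra|].
  intros a b Ha.
  assert (E : dmf (a, b) = (dm (a, b) * f (a, b) + m (a, b) * df (a, b))%C).
  { apply (has_cderiv_unique (fun z => m z * f z)%C (a, b)); [exact (Hmf (a, b) Ha)|].
    exact (has_cderiv_mul _ _ _ _ _ (Hm (a, b) Ha) (Hf (a, b) Ha)). }
  replace (dm (a, b) * f (a, b))%C with (dmf (a, b) - m (a, b) * df (a, b))%C by (rewrite E; ring).
  eapply Rle_trans; [apply Cmod_sub_le|]. rewrite Cmod_mult.
  pose proof (HK (a, b) Ha). pose proof (Cmod_ge_0 (df (a, b))). nra.
Qed.

(** Dependent choice starting from rate 1. The index is shifted because hump n + 1 relates the rates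
    n and n + 1. *)
Lemma rate_sequence (Q : nat -> R -> R -> Prop) :
  (forall n d, 0 < d <= 1 -> exists d', 0 < d' <= d /\ Q n d d') ->
  exists dl, unit_rates dl /\ (forall n, dl (S n) <= dl n) /\
    forall n, Q (S n) (dl n) (dl (S n)).
Proof.
  intros H.
  assert (H' : forall n d, exists d', 0 < d <= 1 -> 0 < d' <= d /\ Q n d d').
  { intros n d. destruct (classic (0 < d <= 1)) as [Hd|Hd]; [|exists d; tauto].
    destruct (H n d Hd) as [d' Hd']. exists d'. auto. }
  set (F := fun n d => proj1_sig (constructive_indefinite_description _ (H' (S n) d))).
  assert (HF : forall n d, 0 < d <= 1 -> 0 < F n d <= d /\ Q (S n) d (F n d)).
  { intros n d. unfold F. destruct (constructive_indefinite_description _ (H' (S n) d)); auto. }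
  set (dl := nat_rect (fun _ => R) 1 F).
  assert (U : unit_rates dl).
  { intros n. induction n as [|n IH]; [simpl; lra|].
    destruct (HF n _ IH) as [T _]. change (dl (S n)) with (F n (dl n)). lra. }
  exists dl. split; [exact U|]. split; intros n; apply (HF n _ (U n)).
Qed.

(* Gliding hump: if the integral diverged, the rates of a lacunary sum f could be
   chosen so that on the n-th strip f is comparable to its n-th term 100^-n while
   the integral of sup |m'| over the strip exceeds 4 n 100^n. *)
Lemma multiplier_B0int (m dm : C -> C) (K : R) : holo_on_Cplus m dm ->
  (forall z, 0 < fst z -> Cmod (m z) <= K) ->
  (forall f, inB0 f -> inB0 (fun z => m z * f z)%C) -> exists K', B0int_le dm K'.
Proof.
  intros Hm HK Hmul. apply NNPP. intros Hno.
  assert (Hf : forall f, inB0 f -> exists K', B0int_le (fun z => dm z * f z)%C K').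
  { intros f Hf. apply (multiplier_deriv_B0int m dm f K); auto. }
  (* On Re z <= A, exp(-z) is at least exp(-A) in modulus, so integrability of m' exp(-z) bounds all
     lower sums left of A. Large sums must therefore come from beyond A. *)
  assert (Far : forall A L, 0 < A -> exists s t v, A <= s /\ lower_step dm s t v /\ L < v).
  { intros A L HA. destruct (Hf _ (inB0_expm 1 ltac:(lra))) as [K1 I1].
    assert (Near : forall s t v, lower_step dm s t v -> t <= A -> v <= K1 * exp A).
    { intros s t v Hv Ht. pose proof (lower_step_pos _ _ _ _ Hv) as Hst.
      assert (T : exp (- A) * v <= K1).
      { apply (proj1 (B0int_le_iff _ _) I1 s t).
        apply (lower_step_scale dm); [apply exp_pos|exact Hv|].
        intros a b Hab. rewrite Cmod_mult, Cmod_expm, Rmult_comm. simpl.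
        apply Rmult_le_compat_l; [apply Cmod_ge_0|]. apply exp_nondecreasing. lra. }
      apply (Rmult_le_compat_r (exp A)) in T; [|left; apply exp_pos].
      replace (exp (- A) * v * exp A) with (v * exp (- A + A)) in T by (rewrite exp_plus; ring).
      rewrite Rplus_opp_l, exp_0, Rmult_1_r in T. exact T. }
    assert (Hbig : exists s t v, lower_step dm s t v /\ Rabs L + Rabs (K1 * exp A) < v).
    { apply NNPP. intros Hn. apply Hno. exists (Rabs L + Rabs (K1 * exp A)).
      apply B0int_le_iff. intros s t v Hv. apply Rnot_lt_le. intros Hlt. apply Hn.
      exists s, t, v. auto. }
    destruct Hbig as (s & t & v & Hv & Hlt).
    pose proof (Rle_abs L). pose proof (Rle_abs (K1 * exp A)).
    pose proof (Rabs_pos L). pose proof (Rabs_pos (K1 * exp A)).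
    destruct (Rle_dec t A) as [HtA|HtA]; [pose proof (Near _ _ _ Hv HtA); lra|].
    destruct (Rle_dec A s) as [HsA|HsA]; [exists s, t, v; repeat split; [lra|exact Hv|lra]|].
    destruct (lower_step_split dm s t v A Hv) as (v1 & v2 & V1 & V2 & E); [lra|].
    pose proof (Near _ _ _ V1 (Rle_refl A)). exists A, t, v2. repeat split; [lra|exact V2|lra]. }
  (* The old rate [d] makes the earlier terms negligible from [s] on; the strip ends at 1/d', before
     the new term has decayed by more than a factor e. *)
  destruct (rate_sequence (fun n d d' => exists s v, 0 < s /\ lower_step dm s (/ d') v /\
     INR n * (4 * 100 ^ n) < v /\ exp (- (d * s)) <= (/ 100) ^ n / 100)) as (dl & Hdl & Mdl & Hseq).
  { intros n d Hd.
    destruct (exp_neg_eventually_lt d ((/ 100) ^ n / 100)) as (A & A0 & HA).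
    { lra. } { pose proof (pow100_pos n). lra. }
    (* Starting beyond [A] gives the decay at the old rate; starting beyond 1/d makes the new rate
       1/t at most d. *)
    destruct (Far (Rmax A (/ d)) (INR n * (4 * 100 ^ n))) as (s & t & v & Hs & Hv & Hlt).
    { eapply Rlt_le_trans; [exact A0|apply Rmax_l]. }
    pose proof (Rmax_l A (/ d)). pose proof (Rmax_r A (/ d)).
    pose proof (lower_step_pos _ _ _ _ Hv) as Hst.
    exists (/ t). split; [split; [apply Rinv_0_lt_compat; lra|]|].
    - rewrite <- (Rinv_inv d). apply Rinv_le_contravar; [apply Rinv_0_lt_compat|]; lra.
    - exists s, v. rewrite Rinv_inv. repeat split; try assumption; [lra|]. apply HA. lra. }
  assert (Mono : forall k j, dl (k + j)%nat <= dl k).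
  { intros k. induction j as [|j IH]; [rewrite Nat.add_0_r; lra|].
    rewrite Nat.add_succ_r. eapply Rle_trans; [apply Mdl|exact IH]. }
  assert (Head : forall n s, 0 < s -> exp (- (dl n * s)) <= (/ 100) ^ (S n) / 100 ->
    forall z, s <= fst z -> Cmod (lac dl z - lac_term dl z (S n))%C <= (/ 100) ^ (S n) / 20).
  { intros n s Hs He z Hz. apply (lac_dominant_term dl s); [exact Hdl|lra| |exact Hz].
    intros k Hk. eapply Rle_trans; [|exact He]. apply exp_nondecreasing.
    pose proof (Mono k (n - k)%nat) as T. replace (k + (n - k))%nat with n in T by lia. nra. }
  assert (Hlac : inB0 (lac dl)).
  { split; [apply inB_lac, Hdl|]. intros eps He.
    destruct (pow_lt_1_zero (/ 100)) with (y := eps / 2) as [n Hn]; [rewrite Rabs_pos_eq; lra|lra|].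
    specialize (Hn (S n) ltac:(lia)). rewrite Rabs_pos_eq in Hn by (left; apply pow100_pos).
    destruct (Hseq n) as (s & v & s0 & _ & _ & He2). exists s. intros z Hz.
    change (s < fst z) in Hz. change (Cmod (lac dl z) < eps).
    pose proof (Head n s s0 He2 z ltac:(lra)) as T.
    pose proof (Cmod_lac_term_le dl z (S n) Hdl ltac:(lra)) as T2.
    pose proof (Cmod_sub_ge (lac dl z) (lac_term dl z (S n))) as T3.
    pose proof (pow100_pos (S n)). lra. }
  destruct (Hf _ Hlac) as [K' HK'].
  destruct (INR_unbounded K') as [n Hn].
  destruct (Hseq n) as (s & v & s0 & Hv & Hlt & He).
  assert (pn : 0 < (/ 100) ^ (S n)) by apply pow100_pos.
  (* On the strip the main term is at least a third of its coefficient, and 1/3 - 1/20 > 1/4. *)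
  assert (T : (/ 100) ^ (S n) / 4 * v <= K').
  { apply (proj1 (B0int_le_iff _ _) HK' s (/ dl (S n))).
    apply (lower_step_scale dm); [lra|exact Hv|].
    intros a b Hab. rewrite Cmod_mult, Rmult_comm. apply Rmult_le_compat_l; [apply Cmod_ge_0|].
    pose proof (Head n s s0 He (a, b) (proj1 Hab)) as T1.
    pose proof (Cmod_sub_ge (lac_term dl (a, b) (S n)) (lac dl (a, b))) as T2.
    rewrite Cmod_sub_sym, Cmod_lac_term in T2. simpl fst in T2.
    assert (T3 : / 3 <= exp (- (dl (S n) * a))).
    { apply Rle_trans with (exp (- (1))).
      - rewrite exp_Ropp. apply Rinv_le_contravar; [apply exp_pos|apply exp_le_3].
      - apply exp_nondecreasing. pose proof (Hdl (S n)).
        assert (dl (S n) * a <= dl (S n) * / dl (S n)) by (apply Rmult_le_compat_l; lra).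
        rewrite Rinv_r in * by lra. lra. }
    nra. }
  apply (Rmult_lt_compat_l ((/ 100) ^ (S n) / 4)) in Hlt; [|lra].
  replace ((/ 100) ^ S n / 4 * (INR (S n) * (4 * 100 ^ S n))) with (INR (S n)) in Hlt.
  2: { rewrite pow_inv. field. apply pow_nonzero. lra. }
  rewrite S_INR in Hlt. lra.
Qed.

(** The tolerance 1/6 is 1/3 times 1/2: as exp(-1) >= 1/3, it yields |f - 1| <= 1/2 on Re z = 1. The
    maximum principle carries this to points where |f| < 1/2, which is absurd. *)
Lemma no_approximate_identity (fs : nat -> C -> C) : (forall n, inB0 (fs n)) ->
  ~ (forall g, inB0 g -> forall eps, 0 < eps -> exists N, forall n, (N <= n)%nat ->
       B0norm_le (fun z => fs n z * g z - g z)%C eps).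
Proof.
  intros Hfs Hlim.
  destruct (Hlim _ (inB0_expm 1 ltac:(lra)) (/ 6) ltac:(lra)) as [N HN].
  destruct (HN N (le_n N)) as (dh & Hh & Ih).
  destruct (Hfs N) as ((df & Hf & (K & HK) & _) & Hdec).
  set (f := fs N) in *. set (h := fun z : C => (f z * expm 1 z - expm 1 z)%C) in *.
  assert (Eh : forall z, Cmod (h z) = Cmod (f z - 1)%C * exp (- fst z)).
  { intros z. unfold h. replace (f z * expm 1 z - expm 1 z)%C with ((f z - 1) * expm 1 z)%C by ring.
    rewrite Cmod_mult, Cmod_expm, Rmult_1_l. reflexivity. }
  assert (BK : forall z, 0 < fst z -> Cmod (f z - 1)%C <= K + 1).
  { intros z Hz. eapply Rle_trans; [apply Cmod_sub_le|]. rewrite Cmod_1.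
    pose proof (HK z Hz) as T. change (Cmod (f z) <= K) in T. lra. }
  assert (K0 : 0 <= K + 1) by (eapply Rle_trans; [apply Cmod_ge_0|apply (BK (1, 0)); exact Rlt_0_1]).
  assert (Line : forall b, Cmod (f (1, b) - 1)%C <= / 2).
  { intros b.
    assert (T : Cmod (h (1, b)) <= / 6).
    (* The integral controls only increments; the value at Re z = 1 is recovered because h decays
       like exp(-t) along the horizontal ray. *)
    { apply le_epsilon. intros eps He.
      destruct (exp_neg_eventually_lt 1 (eps / (K + 2))) as (A & A0 & HA);
        [lra|apply Rdiv_lt_0_compat; lra|].
      set (t := Rmax A 2). pose proof (Rmax_l A 2). pose proof (Rmax_r A 2).
      pose proof (B0int_increment h dh (/ 6) 1 t b Hh Ih ltac:(lra) ltac:(unfold t; lra)) as T1.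
      pose proof (Cmod_sub_ge (h (1, b)) (h (t, b))) as T2. rewrite Cmod_sub_sym in T2.
      assert (T3 : Cmod (h (t, b)) <= eps).
      { rewrite Eh. simpl fst. specialize (HA t ltac:(unfold t; lra)). rewrite Rmult_1_l in HA.
        pose proof (BK (t, b) ltac:(simpl; unfold t; lra)) as T4.
        apply Rle_trans with ((K + 1) * (eps / (K + 2))).
        - apply Rmult_le_compat; [apply Cmod_ge_0|left; apply exp_pos|exact T4|exact HA].
        - replace eps with ((K + 2) * (eps / (K + 2))) at 2 by (field; lra).
          apply Rmult_le_compat_r; [left; apply Rdiv_lt_0_compat|]; lra. }
      lra. }
    rewrite Eh in T. simpl fst in T.
    assert (/ 3 <= exp (- (1)))
      by (rewrite exp_Ropp; apply Rinv_le_contravar; [apply exp_pos|apply exp_le_3]).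
    pose proof (Cmod_ge_0 (f (1, b) - 1)%C). nra. }
  destruct (Hdec (/ 2) ltac:(lra)) as [A HA].
  set (a := Rmax A 1 + 1). pose proof (Rmax_l A 1). pose proof (Rmax_r A 1).
  assert (T : Cmod (f (a, 0) - 1)%C <= / 2).
  (* The constant 1 is written as an affine function so that [has_cderiv_affine] differentiates
     it. *)
  { assert (E1 : forall z : C, (1 + 0 * z)%C = 1%C) by (intros z; ring).
    replace (f (a, 0) - 1)%C with (f (a, 0) - (1 + 0 * (a, 0)))%C by (rewrite E1; reflexivity).
    apply (half_plane_max (fun z => f z - (1 + 0 * z))%C (fun z => df z - 0)%C (K + 1)).
    - intros z Hz. apply has_cderiv_sub; [exact (Hf z Hz)|apply has_cderiv_affine].
    - intros z Hz. rewrite E1. apply BK, Hz.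
    - intros b. rewrite E1. apply Line.
    - unfold a; lra. }
  pose proof (HA (a, 0) ltac:(unfold Defs.Re, a; simpl; lra)) as T2.
  change (Cmod (f (a, 0)) < / 2) in T2.
  pose proof (Cmod_sub_ge 1 (f (a, 0))) as T3. rewrite Cmod_1, Cmod_sub_sym in T3. lra.
Qed.

Theorem mainTheorem13 :
  (~ exists fs : nat -> Cx -> Cx,
       (forall n, inB0 (fs n)) /\
       (forall g, inB0 g ->
          forall eps, 0 < eps -> exists N, forall n, (N <= n)%nat ->
            B0norm_le (fun z => Csub (Cmul (fs n z) (g z)) (g z)) eps))
  /\
  (forall m : Cx -> Cx, in_Ms m <-> inB m).
Proof.
  split.
  - intros (fs & Hfs & Hlim). exact (no_approximate_identity fs Hfs Hlim).
  - intros m. split.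
    + intros [[dm Hm] Hmul].
      destruct (multiplier_bounded m dm Hm Hmul) as [K HK].
      exists dm. split; [exact Hm|]. split; [exists K; exact HK|].
      exact (multiplier_B0int m dm K Hm HK Hmul).
    + intros Hm. split.
      * destruct Hm as (dm & Hm & _). exists dm. exact Hm.
      * intros f Hf. exact (inB0_mul m f Hm Hf).
Qed.
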